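(* Let $N\in\mathbb{N}_0$ and let $\{Q(n;\lambda(x);\beta;N): n\in\mathbb{N}_0^p,\ |n|\le N\}$ be a family of polynomials that spans $\mathcal{P}_\lambda^N$, such that each $Q(n;\lambda(x);\beta;N)\in\mathcal P_\lambda$ is a polynomial of total degree $|n|$ in $\lambda_1,\dots,\lambda_p$ which is orthogonal to all polynomials in $\mathcal{P}_\lambda^{|n|-1}$ with respect to the Racah inner product $\langle\cdot,\cdot\rangle$. Then the polynomials $Q(n;\lambda(x);\beta;N)$ are eigenfunctions of the operator $\mathcal{L}_p=\mathcal{L}_p(x;\beta;N)$ with eigenvalue $-|n|(|n|-1+\beta_{p+1}-\beta_0)$, i.e. $$\mathcal{L}_p\,Q(n;\lambda(x);\beta;N)=-|n|\,(|n|-1+\beta_{p+1}-\beta_0)\,Q(n;\lambda(x);\beta;N).$$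
   Context: Notation: $p\ge1$, $x=(x_1,\dots,x_p)$, $\beta=(\beta_0,\dots,\beta_{p+1})\in\mathbb{R}^{p+2}$, $|n|=n_1+\cdots+n_p$. Put $\lambda_i=x_i(x_i+\beta_i)$ for $1\le i\le p$, $\mathcal{P}_\lambda=\mathbb{R}[\lambda_1,\dots,\lambda_p]\subset\mathbb{R}[x_1,\dots,x_p]$, and let $\mathcal{P}_\lambda^d$ be the space of elements of $\mathcal{P}_\lambda$ of total degree at most $d$ in $\lambda_1,\dots,\lambda_p$ ($\mathcal{P}_\lambda^{-1}=\{0\}$). The operator $\mathcal{L}_p$: $E_{x_i}$ is the shift $f(x)\mapsto f(x+e_i)$, $\triangle_{x_i}=E_{x_i}-1$, $\nabla_{x_i}=1-E_{x_i}^{-1}$, with multi-index notation $\triangle_x^\mu=\prod_j\triangle_{x_j}^{\mu_j}$, $\nabla_x^\mu=\prod_j\nabla_{x_j}^{\mu_j}$. Let $I_i$ be the substitution $x_i\mapsto -x_i-\beta_i$ (other variables fixed) on rational functions. For $\nu\in\{0,1\}^p\setminus\{0\}$ with nonzero components at positions $i_1<\cdots<i_s$ put $$A_\nu=(x_{i_1}+\beta_{i_1}-\beta_0)(x_{i_1}+\beta_{i_1})\,\frac{\prod_{k=2}^s(x_{i_k}+x_{i_{k-1}}+\beta_{i_k})(x_{i_k}+x_{i_{k-1}}+\beta_{i_k}+1)}{\prod_{k=1}^s(2x_{i_k}+\beta_{i_k})(2x_{i_k}+\beta_{i_k}+1)}\,(x_{i_s}+\beta_{p+1}+N)(N-x_{i_s}).$$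 For $\nu\in\mathbb{Z}^p$ put $\nu_j^+=\max(\nu_j,0)$, $\nu_j^-=-\min(\nu_j,0)$. For $\nu\in\{-1,0,1\}^p\setminus\{0,1\}^p$ put $A_\nu=I^{\nu^-}(A_{\nu^++\nu^-})$, where $I^{\nu^-}$ is the composition of the $I_i$ with $\nu_i^-=1$. Then $$\mathcal{L}_p=\sum_{\nu\in\{-1,0,1\}^p\setminus\{0\}}(-1)^{|\nu^-|}A_\nu\,\triangle_x^{\nu^+}\nabla_x^{\nu^-}.$$ Racah inner product on $\mathcal{P}_\lambda^N$: $\langle f,g\rangle=\sum_{x\in V_N}f(x)g(x)\rho(x)$, where, with $x_0=0$ and $x_{p+1}=N$, $V_N=\{x\in\mathbb{N}_0^p: 0=x_0\le x_1\le\cdots\le x_p\le x_{p+1}=N\}$ and $$\rho(x)=\prod_{k=0}^p\frac{\Gamma(\beta_{k+1}-\beta_k+x_{k+1}-x_k)\,\Gamma(\beta_{k+1}+x_{k+1}+x_k)}{(x_{k+1}-x_k)!\,\Gamma(\beta_k+1+x_{k+1}+x_k)}\prod_{k=1}^p(\beta_k+2x_k).$$ The parameters $\beta$ are assumed to be such that $\rho$ is well defined on $V_N$ and $\langle\cdot,\cdot\rangle$ is an inner product (positive definite) on $\mathcal{P}_\lambda^N$. *)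

(* Defs.v *)
From HB Require Import structures.
From mathcomp Require Import all_boot all_order all_algebra.
(* mpoly must be imported before the analysis files: in the other order their
   notations clash. *)
From mathcomp Require Import mpoly.
From mathcomp Require Import boolp classical_sets reals topology normedtype.
From mathcomp Require Import sequences exp.

Set Implicit Arguments.
Unset Strict Implicit.
Unset Printing Implicit Defensive.

Import Order.TTheory GRing.Theory Num.Theory.
Import numFieldNormedType.Exports.

Local Open Scope classical_set_scope.
Local Open Scope ring_scope.

(* Gauss' formula, valid on the whole domain of Gamma (negative non-integers
   included):  Gamma z = lim_n n! n^z / (z (z+1) ... (z+n)).  As 0^-1 = 0, the
   sequence is eventually 0 when z is a nonpositive integer, so both Gamma z
   and (Gamma z)^-1 are 0 there. *)
Definition Gamma (R : realType) (z : R) : R :=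
  lim ((fun n : nat =>
          n`!%:R * n%:R `^ z / \prod_(k < n.+1) (z + k%:R)) @ \oo).

Definition Gamma_pole (R : realType) (z : R) : Prop :=
  exists m : nat, z = - m%:R.

(* Extension of an injective ring endomorphism to the fraction field. *)
Definition frac_map (D : idomainType) (phi : D -> D) (f : {fraction D}) :
    {fraction D} :=
  FracField.tofrac (phi \n_(repr f)) / FracField.tofrac (phi \d_(repr f)).

(* The indices 1, ..., p are represented by 'I_p: the variable x_(i+1) is 'X_i
   for i : 'I_p, whereas beta_0, ..., beta_(p+1) keep their own numbering. *)
Section Racah.

Variables (R : realType) (p : nat) (beta : 'I_p.+2 -> R) (N : nat).

Local Notation poly := {mpoly R[p]}.
Local Notation ratfun := {fraction {mpoly R[p]}}.
Local Notation "x %:F" := (FracField.tofrac x).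
Local Notation "beta_( k )" := (beta (inord k)) (format "beta_( k )").

Definition lambda : p.-tuple poly :=
  [tuple 'X_i * ('X_i + (beta_(i.+1))%:MP) | i < p].

(* msize h is the total degree of h plus one, and msize 0 = 0. *)
Definition in_Plambda_le (d : int) (f : poly) : Prop :=
  exists h : {mpoly R[p]}, ((msize h)%:Z <= d + 1) /\ f = h \mPo lambda.

Definition Plambda_degree (d : nat) (f : poly) : Prop :=
  exists h : {mpoly R[p]}, msize h = d.+1 /\ f = h \mPo lambda.

Definition subst_var (i : 'I_p) (q : poly) (f : poly) : poly :=
  f \mPo [tuple if j == i then q else 'X_j | j < p].

Definition shift (i : 'I_p) : ratfun -> ratfun :=
  frac_map (subst_var i ('X_i + 1)).

Definition shift_inv (i : 'I_p) : ratfun -> ratfun :=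
  frac_map (subst_var i ('X_i - 1)).

Definition reflect_var (i : 'I_p) : ratfun -> ratfun :=
  frac_map (subst_var i (- 'X_i - (beta_(i.+1))%:MP)).

Definition fdiff (i : 'I_p) (f : ratfun) : ratfun := shift i f - f.

Definition bdiff (i : 'I_p) (f : ratfun) : ratfun := f - shift_inv i f.

(* D_1^(mu_1) ... D_p^(mu_p) f *)
Definition multi_pow (D : 'I_p -> ratfun -> ratfun) (mu : 'I_p -> nat)
    (f : ratfun) : ratfun :=
  foldr (fun i g => iter (mu i) (D i) g) f (enum 'I_p).

Definition pos_part (nu : 'I_p -> int) (j : 'I_p) : nat :=
  `|Num.max (nu j) 0|%N.

Definition neg_part (nu : 'I_p -> int) (j : 'I_p) : nat :=
  `|- Num.min (nu j) 0|%N.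

(* s lists the positions i_1 < ... < i_s of the nonzero components of mu, and
   zip s t the pairs (i_(k-1), i_k) for 2 <= k <= s. The value at mu = 0 is
   never used. *)
Definition A01 (mu : 'I_p -> nat) : ratfun :=
  let x i : ratfun := ('X_i)%:F in
  let b k : ratfun := ((beta_(k))%:MP)%:F in
  let s := [seq i <- enum 'I_p | mu i != 0%N] in
  if s is i1 :: t then
    let il := last i1 t in
    (x i1 + b i1.+1 - b 0%N) * (x i1 + b i1.+1) *
    (\prod_(ij <- zip s t)
       ((x ij.2 + x ij.1 + b ij.2.+1) * (x ij.2 + x ij.1 + b ij.2.+1 + 1)) /
     \prod_(i <- s)
       ((2 * x i + b i.+1) * (2 * x i + b i.+1 + 1))) *
    (x il + b p.+1 + N%:R) * (N%:R - x il)
  else 0.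

(* For nu in {0,1}^p this is A01 nu, since the composition of reflections is
   then empty. *)
Definition A (nu : 'I_p -> int) : ratfun :=
  multi_pow reflect_var (neg_part nu)
    (A01 (fun i => (pos_part nu i + neg_part nu i)%N)).

(* {-1,0,1}^p is enumerated by functions into 'I_3. *)
Definition sgn_index (e : {ffun 'I_p -> 'I_3}) (i : 'I_p) : int :=
  (e i)%:Z - 1.

Definition Lp (f : ratfun) : ratfun :=
  \sum_(e : {ffun 'I_p -> 'I_3} | [exists i, sgn_index e i != 0])
    (let nu := sgn_index e in
     (-1) ^+ (\sum_i neg_part nu i)%N * A nu *
       multi_pow fdiff (pos_part nu) (multi_pow bdiff (neg_part nu) f)).

(* A point (x_1, ..., x_p) extended by x_0 = 0 and x_(p+1) = N. *)
Definition ext_point (x : {ffun 'I_p -> 'I_N.+1}) (k : nat) : nat :=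
  if k is k'.+1 then
    (if insub k' is Some i then nat_of_ord (x i) else N) else 0%N.

(* The constraints 0 <= x_1 <= ... <= x_p <= N force x_i <= N, so that V_N is
   a subset of {0, ..., N}^p. *)
Definition in_VN (x : {ffun 'I_p -> 'I_N.+1}) : bool :=
  [forall k : 'I_p.+1, (ext_point x k <= ext_point x k.+1)%N].

Definition rho (x : {ffun 'I_p -> 'I_N.+1}) : R :=
  let X := ext_point x in
  (\prod_(k < p.+1)
     (Gamma (beta_(k.+1) - beta_(k) + (X k.+1)%:R - (X k)%:R) *
      Gamma (beta_(k.+1) + (X k.+1)%:R + (X k)%:R) /
      ((X k.+1 - X k)`!%:R *
       Gamma (beta_(k) + 1 + (X k.+1)%:R + (X k)%:R)))) *
  \prod_(1 <= k < p.+1) (beta_(k) + 2 * (X k)%:R).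

(* No Gamma factor in a numerator of rho is evaluated at a pole. A pole in a
   denominator is harmless for well-definedness (1 / Gamma is entire, with
   value 0 there). *)
Definition rho_well_defined : Prop :=
  forall x : {ffun 'I_p -> 'I_N.+1}, in_VN x -> forall k : 'I_p.+1,
    let X := ext_point x in
    ~ Gamma_pole (beta_(k.+1) - beta_(k) + (X k.+1)%:R - (X k)%:R) /\
    ~ Gamma_pole (beta_(k.+1) + (X k.+1)%:R + (X k)%:R).

Definition racah_ip (f g : poly) : R :=
  \sum_(x : {ffun 'I_p -> 'I_N.+1} | in_VN x)
    f.@[fun i => (x i)%:R] * g.@[fun i => (x i)%:R] * rho x.

Definition racah_pos_def : Prop :=
  forall f : poly, in_Plambda_le N%:Z f -> f != 0 -> 0 < racah_ip f f.

End Racah.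

(* Main.v *)
Require Import Defs.
From HB Require Import structures.
From mathcomp Require Import all_boot all_order all_algebra.
From mathcomp Require Import mpoly.
From mathcomp Require Import boolp classical_sets reals topology normedtype.
From mathcomp Require Import sequences exp.
From mathcomp Require Import ring lra zify.

Set Implicit Arguments.
Unset Strict Implicit.
Unset Printing Implicit Defensive.

Import Order.TTheory GRing.Theory Num.Theory.
Import numFieldNormedType.Exports.
Local Open Scope ring_scope.

(** The operator is triangular for the degree filtration of P_lambda, with the
    stated eigenvalues on the diagonal, and it is self-adjoint for the Racah inner
    product.  Hence, for Q of degree d that is orthogonal to P_lambda^(d-1) and
    e = d (d - 1 + beta_(p+1) - beta_0), the polynomial q = L Q + e Q lies in
    P_lambda^(d-1), and <q, q> = <Q, L q> + e <Q, q> = 0 as L q also lies in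
    P_lambda^(d-1).  Positivity gives q = 0 ([Lpoly_eigen]).

    Both properties come from the shape of the coefficients.  For a set S of
    positions, A_S is a product of one factor [link] for each two consecutive
    elements of {0} u S u {p+1}, over the site denominators (2 x + b) (2 x + b + 1).
    On polynomials that are invariant under the reflections x_i -> - x_i - beta_i,
    which are those of P_lambda, a backward difference is a reflected forward
    difference, so that L f is the sum over S of A_S Delta_S f and its images
    under the reflections of the sites of S ([Lp_tofrac]).

    Triangularity.  The forward difference of an invariant f is divisible by
    2 x_i + b_i + 1, and the sum of h / (2 x_i + b_i) and its reflection is a
    divided difference of h.  So L f is an invariant polynomial ([chain_op]).  In
    the centred variables u_i = x_i + b_i / 2 the divided difference picks the odd
    part, and the leading terms on products of even powers of the u_i are computed
    by adding one site at a time ([chain_op_lead1], [chain_op_lead0]).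

    Self-adjointness.  Expanding the differences into shifts, the coefficient of
    a given shift is a sum over all S that contain its support.  The identity
    [link_site] sums over the presence of one site, and turns that sum into a
    product over all consecutive sites 0, ..., p+1 ([diff_chain_shift_chain]).  The
    Racah weight is a product over the same links, and the relation
    Gamma (z + 1) = z Gamma z gives detailed balance for each of them ([link_sym]).
    Moves that leave the lattice domain have weight 0.  The denominators
    2 x - 1 + b of the expansion can vanish only at x = 0 (when b = 1); the backward
    terms at x = 0 have numerator 0 before the expansion, and without them the
    identity [link_site0] replaces [link_site]. *)

(** * Link weights and summation over one site *)

(** The state of a site is a triple [(moved, y, beta)]: whether a shift acts on
    the site, its coordinate (after a possible reflection), and its parameter.
    [A_nu] is the product of the links between consecutive moved sites, from the
    unmoved site 0 (at 0) to the unmoved site p + 1 (at N), over the site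
    denominators.  The entry for two unmoved sites is the one that makes
    [link_site] true.  *)
Definition link (K : comUnitRingType) (s t : bool * K * K) : K :=
  let: (a, yl, bl) := s in let: (c, ym, bm) := t in
  match a, c with
  | true, true => (ym + yl + bm) * (ym + yl + bm + 1)
  | false, true => (ym + yl + bm) * (ym - yl + bm - bl)
  | true, false => (ym - yl) * (ym + yl + bm)
  | false, false => yl * (yl + bl) + ym * (ym + bm) + (bl + 1) * (bm - 1) / 2
  end.

(** This rational identity turns differences into shifts: summing over the three
    states of one site (moved forward, moved backward, not moved) gives back the
    chain from which the site has been deleted. *)
Lemma link_site (K : fieldType) (s t : bool * K * K) (y b : K) :
  2 != 0 :> K -> 2 * y + b != 0 -> 2 * y + b + 1 != 0 -> 2 * y + b - 1 != 0 ->
  link s t =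
    link s (true, y, b) / ((2 * y + b) * (2 * y + b + 1)) * link (true, y, b) t +
    link s (true, - y - b, b) /
      ((2 * (- y - b) + b) * (2 * (- y - b) + b + 1)) * link (true, - y - b, b) t
    + 2 * link s (false, y, b) / ((2 * y + b + 1) * (2 * y + b - 1)) *
        link (false, y, b) t.
Proof.
move=> n2 n0 n1 nm1; case: s => [[a yl] bl]; case: t => [[c ye] be].
have nr0 : 2 * (- y - b) + b != 0.
  by rewrite (_ : _ + b = - (2 * y + b)) ?oppr_eq0 //; ring.
have nr1 : 2 * (- y - b) + b + 1 != 0.
  by rewrite (_ : _ + 1 = - (2 * y + b - 1)) ?oppr_eq0 //; ring.
by case: a; case: c => /=; field; rewrite ?n2 ?n0 ?n1 ?nm1 ?nr0 ?nr1.
Qed.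

(** The same at y = 0 when the left neighbour is at 0 too.  The backward term
    has vanished with its numerator, and the last coefficient is the value of
    the removable singularity of the one in [link_site] at b = 1. *)
Lemma link_site0 (K : fieldType) (a : bool) (t : bool * K * K) (bl b : K) :
  2 != 0 :> K -> b != 0 -> b + 1 != 0 ->
  link (a, 0, bl) t =
    link (a, 0, bl) (true, 0, b) / ((2 * 0 + b) * (2 * 0 + b + 1)) *
      link (true, 0, b) t
    + (if a then 0 else (bl + 1) / (b + 1)) * link (false, 0, b) t.
Proof.
move=> n2 n0 n1; case: t => [[c ye] be]; rewrite mulr0 add0r.
by case: a; case: c => /=; field; rewrite ?n2 ?n0 ?n1.
Qed.

(** * Iterated sums and chains at a lattice point *)

Arguments link : simpl never.

Definition upd (I : eqType) (T : Type) (v : I -> T) (i : I) (t : T) : I -> T :=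
  fun j => if j == i then t else v j.

Lemma upd_same (I : eqType) (T : Type) (v : I -> T) i t : upd v i t i = t.
Proof. by rewrite /upd eqxx. Qed.

Lemma upd_other (I : eqType) (T : Type) (v : I -> T) i t j :
  j != i -> upd v i t j = v j.
Proof. by rewrite /upd => /negbTE ->. Qed.

Lemma upd_id (I : eqType) (T : Type) (v : I -> T) i : upd v i (v i) = v.
Proof. by apply/funext => j; rewrite /upd; case: eqP => [->|]. Qed.

(** One coordinate is summed at a time, which is the shape that the chains below
    unfold to; [iter_sum_ffun] turns the result into a sum over finite functions. *)
Fixpoint iter_sum (I : eqType) (V : nmodType) (n : nat) (r : seq I)
    (H : (I -> nat) -> V) (v : I -> nat) : V :=
  if r is m :: r' then \sum_(y < n) iter_sum n r' H (upd v m y) else H v.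

Section GSum.
Variables (I : eqType) (V : nmodType) (n : nat).
Implicit Types (r : seq I) (H : (I -> nat) -> V).

Lemma eq_iter_sum r H1 H2 v :
  (forall e, (forall j, j \notin r -> e j = v j) ->
             (forall j, j \in r -> (e j < n)%N) -> H1 e = H2 e) ->
  iter_sum n r H1 v = iter_sum n r H2 v.
Proof.
elim: r v => [|m r IH] v eqH /=; first by apply: eqH.
apply: eq_bigr => y _.
have [mr|mr] := boolP (m \in r).
  apply: IH => e eo ei; apply: eqH => j.
    rewrite inE negb_or => /andP[jm jr].
    by rewrite eo // upd_other.
  by rewrite inE => /orP[/eqP ->|]; apply: ei.
apply: IH => e eo ei; apply: eqH => j.
  by rewrite inE negb_or => /andP[jm jr]; rewrite eo // upd_other.
rewrite inE => /orP[/eqP ->|]; last exact: ei.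
by rewrite eo // upd_same.
Qed.

Lemma iter_sum0 r H v : (forall e, H e = 0) -> iter_sum n r H v = 0.
Proof.
by move=> H0; elim: r v => [|m r IH] v //=; rewrite big1.
Qed.

Lemma iter_sum_morph (W : nmodType) (phi : {additive V -> W}) r H v :
  phi (iter_sum n r H v) = iter_sum n r (fun e => phi (H e)) v.
Proof.
elim: r v => [|m r IH] v //=; rewrite raddf_sum.
by apply: eq_bigr => y _.
Qed.

End GSum.

Lemma iter_sumMl (I : eqType) (V : pzSemiRingType) (n : nat) (r : seq I)
    (c : V) (H : (I -> nat) -> V) v :
  c * iter_sum n r H v = iter_sum n r (fun e => c * H e) v.
Proof.
elim: r v => [|m r IH] v //=; rewrite mulr_sumr.
by apply: eq_bigr => y _.
Qed.

(** Both the sum over sign vectors in the operator and the sum over lattice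
    points in the inner product enter the chain computations through this
    lemma, with n = 3 and n = N + 1. *)
Lemma iter_sum_ffun (p n : nat) (V : nmodType) (H : ('I_p -> nat) -> V)
    (v : 'I_p -> nat) :
  iter_sum n (enum 'I_p) H v =
  \sum_(e : {ffun 'I_p -> 'I_n}) H (fun i => nat_of_ord (e i)).
Proof.
have main (r : seq 'I_p) (w : 'I_p -> nat) : uniq r ->
    (forall j, j \notin r -> (w j < n)%N) ->
    iter_sum n r H w =
    \sum_(e : {ffun 'I_p -> 'I_n} | [forall j, (j \notin r) ==> (e j == w j :> nat)])
       H (fun i => nat_of_ord (e i)).
  elim: r w => [|m r IH] w /=.
    move=> _ wn.
    have wn' j : (w j < n)%N by apply: wn.
    rewrite (big_pred1 [ffun j => Ordinal (wn' j)]).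
      by congr H; apply/funext => j; rewrite ffunE.
    move=> e; apply/forallP/eqP => [eq|-> j].
      apply/ffunP => j; apply/val_inj; rewrite ffunE /=.
      by have /eqP := eq j.
    by rewrite ffunE /=.
  move=> /andP[mr ur] wn.
  rewrite (partition_big (fun e : {ffun 'I_p -> 'I_n} => e m) predT) //=.
  apply: eq_bigr => y _; rewrite IH //; last first.
    move=> j jr; rewrite /upd; case: eqP => [_|/eqP jm]; first exact: ltn_ord.
    by apply: wn; rewrite inE negb_or jm.
  apply: eq_bigl => e; apply/forallP/andP => [eq|[/forallP eq /eqP em] j].
    split; last by have := eq m; rewrite mr upd_same.
    apply/forallP => j; apply/implyP; rewrite inE negb_or => /andP[jm jr].
    by have := eq j; rewrite jr upd_other.
  apply/implyP => jr; have [->|jm] := eqVneq j m; first by rewrite em upd_same.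
  by have := eq j; rewrite inE negb_or jm jr upd_other.
rewrite main ?enum_uniq //; last by move=> j; rewrite mem_enum.
by apply: eq_bigl => e; apply/forallP => j; rewrite mem_enum.
Qed.

Section Grid.
Variables (K : numFieldType) (I : eqType) (b : I -> K) (tend : bool * K * K).
Hypothesis bnat : forall i n, b i != - n%:R.

Implicit Types (x v : I -> nat) (r : seq I) (m : I).

(** A backward shift is a reflected forward shift, so a site that moves down
    carries the reflected coordinate. *)
Definition moved (xm ym : nat) (bm : K) : bool * K * K :=
  (ym != xm, if (xm <= ym)%N then xm%:R else - xm%:R - bm, bm).

Definition neighbours (xm : nat) : seq nat :=
  if xm is k.+1 then [:: k; k.+2] else [:: 1%N].

Definition site_den (z bm : K) : K := (2 * z + bm) * (2 * z + bm + 1).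

(** At 0 the generic coefficient has the factor 2 x + b - 1 in its denominator,
    which vanishes there if b = 1; the first branch is its value by continuity
    when the left neighbour is at 0 as well. *)
Definition stay (s : bool * K * K) (xm : nat) (bm : K) : K :=
  if xm == 0%N then (if s.1.1 then 0 else (s.2 + 1) / (bm + 1))
  else 2 * link s (false, xm%:R, bm) /
       ((2 * xm%:R + bm + 1) * (2 * xm%:R + bm - 1)).

Definition hop (s t : bool * K * K) : K := link s t / site_den t.1.2 t.2.

Definition step (s : bool * K * K) (xm ym : nat) (bm : K) : K :=
  if ym == xm then stay s xm bm
  else if (ym == xm.+1) || (xm == ym.+1) then hop s (moved xm ym bm) else 0.

(** Expanded, this is a sum over the moved sites and their directions, as in the
    definition of the operator.  A site at 0 has no backward neighbour, because
    the corresponding numerator is 0. *)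
Fixpoint diff_chain x (s : bool * K * K) r (G : (I -> nat) -> K) v : K :=
  if r is m :: r' then
    \sum_(y <- neighbours (x m)) hop s (moved (x m) y (b m)) *
       (diff_chain x (moved (x m) y (b m)) r' G (upd v m y) -
        diff_chain x (moved (x m) y (b m)) r' G v)
    + diff_chain x s r' G v
  else link s tend * G v.

(** The operator written with shifts; every site of [r] occurs in every term, so
    the coefficients are products over consecutive sites. *)
Fixpoint shift_chain x (s : bool * K * K) r (G : (I -> nat) -> K) v : K :=
  if r is m :: r' then
    \sum_(y <- neighbours (x m)) hop s (moved (x m) y (b m)) *
       shift_chain x (moved (x m) y (b m)) r' G (upd v m y)
    + stay s (x m) (b m) * shift_chain x (moved (x m) (x m) (b m)) r' G v
  else link s tend * G v.

Fixpoint chain_kernel x (s : bool * K * K) r (y : I -> nat) : K :=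
  if r is m :: r' then
    step s (x m) (y m) (b m) * chain_kernel x (moved (x m) (y m) (b m)) r' y
  else link s tend.

Lemma n2_neq0 : 2 != 0 :> K. Proof. by rewrite pnatr_eq0. Qed.

Lemma moved_id xm bm : moved xm xm bm = (false, xm%:R, bm).
Proof. by rewrite /moved eqxx leqnn. Qed.

Lemma moved_up k bm : moved k k.+1 bm = (true, k%:R, bm).
Proof. by rewrite /moved gtn_eqF // leqnSn. Qed.

Lemma moved_down k bm : moved k.+1 k bm = (true, - k.+1%:R - bm, bm).
Proof. by rewrite /moved ltn_eqF // ltnn. Qed.

Lemma link_split (s t : bool * K * K) (xm : nat) m :
  (xm = 0%N -> s.1.2 = 0) ->
  link s t = \sum_(y <- neighbours xm) hop s (moved xm y (b m)) *
    link (moved xm y (b m)) t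
           + stay s xm (b m) * link (moved xm xm (b m)) t.
Proof.
move=> s0; have n2 := n2_neq0.
have nb k : b m + k%:R != 0 by rewrite addr_eq0.
case: xm s0 => [|k] s0; rewrite moved_id /neighbours ?big_cons ?big_nil.
  case: s s0 => [[a yl] bl] /= /(_ erefl) ->.
  rewrite (@link_site0 _ a t bl (b m)) //.
  - by rewrite addr0 /hop /moved /site_den /stay.
  - by have := nb 0%N; rewrite addr0.
  - exact: (nb 1%N).
rewrite addr0 (@link_site _ s t k.+1%:R (b m)) //; last 3 first.
- by rewrite addrC -natrM.
- by rewrite (addrC (2 * _)) -addrA -natrM natr1.
- rewrite (_ : _ - 1 = b m + (k.*2.+1)%:R) //.
  rewrite -(natr1 k.*2) -mul2n natrM -(natr1 k); ring.
rewrite /hop moved_up moved_down /site_den /stay /= [X in _ = X + _]addrC.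
by congr (_ + _); rewrite [in RHS]addrC.
Qed.

(** A chain in difference form depends on the state at its left end through
    [link] only, so [link_site] can insert a site there that the function does
    not see. *)
Lemma diff_chain_split x s r G v m :
  (x m = 0%N -> s.1.2 = 0) ->
  diff_chain x s r G v =
  \sum_(y <- neighbours (x m)) hop s (moved (x m) y (b m)) *
       diff_chain x (moved (x m) y (b m)) r G v
  + stay s (x m) (b m) * diff_chain x (moved (x m) (x m) (b m)) r G v.
Proof.
move=> s0; elim: r v => [|m' r IH] v /=.
  rewrite (link_split tend m s0) mulrDl mulr_suml mulrA.
  by congr (_ + _); apply: eq_bigr => y _; rewrite mulrA.
rewrite {1}IH.
under eq_bigr => y' _ do
  rewrite {1}/hop (link_split _ m s0) mulrDl mulrDl mulr_suml mulr_suml.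
rewrite big_split /=.
under [in RHS]eq_bigr => y _ do rewrite mulrDr mulr_sumr.
rewrite big_split /= mulrDr mulr_sumr exchange_big /= !addrA.
congr (_ + _); rewrite -!addrA; congr (_ + _); last first.
  rewrite addrC; congr (_ + _); apply: eq_bigr => y' _.
  by rewrite /hop !mulrA.
by apply: eq_bigr => y' _; apply: eq_bigr => y _; rewrite /hop !mulrA.
Qed.

(** The lattice points are nondecreasing, so a site can be at 0 only if all sites
    before it are; then [link_site0] applies. *)
Definition admissible x (s : bool * K * K) r :=
  (forall m, m \in r -> x m = 0%N -> s.1.2 = 0) /\
  sorted (fun i j => x i <= x j)%N r.

Lemma admissible_cons x s m r : admissible x s (m :: r) ->
  [/\ x m = 0%N -> s.1.2 = 0, admissible x s r,
      admissible x (moved (x m) (x m) (b m)) r &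
      forall k : nat, k \in neighbours (x m) -> admissible x (moved (x m) k (b m)) r].
Proof.
move=> [g0 gs].
have gs' : sorted (fun i j => x i <= x j)%N r by apply: path_sorted gs.
have tr : transitive (fun i j => x i <= x j)%N by move=> i j k; apply: leq_trans.
have ge j : j \in r -> (x m <= x j)%N by have /allP := order_path_min tr gs; apply.
split.
- by apply: g0; rewrite mem_head.
- by split=> // j jr; apply: g0; rewrite inE jr orbT.
- split=> // j jr xj; rewrite moved_id /=.
  by have := ge _ jr; rewrite xj leqn0 => /eqP ->.
- move=> y; split=> // j jr xj.
  by have := ge _ jr; rewrite xj leqn0 => /eqP ->.
Qed.

(** At each site the differences contribute the shifts minus the unshifted
    function, and [diff_chain_split] absorbs the latter. *)
Lemma diff_chain_shift_chain x s r G v : admissible x s r ->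
  diff_chain x s r G v = shift_chain x s r G v.
Proof.
elim: r s v => [|m r IH] s v //= /admissible_cons[g0 gr gm gy].
rewrite (diff_chain_split _ _ _ g0) addrA -big_split /=; congr (_ + _).
  rewrite big_seq [RHS]big_seq; apply: eq_bigr => y /gy g.
  by rewrite -mulrDr subrK IH.
by rewrite IH.
Qed.

Lemma iter_sum_const r v (n : nat) m (phi : nat -> K) H : m \notin r ->
  iter_sum n r (fun y => phi (y m) * H y) v = phi (v m) * iter_sum n r H v.
Proof.
elim: r v => [|m' r IH] v //=; rewrite inE negb_or => /andP[mm mr].
rewrite mulr_sumr; apply: eq_bigr => y _.
by rewrite IH // upd_other.
Qed.

Lemma shift_chain_iter_sum x s r G v n : uniq r -> {in r, v =1 x} ->
  (forall m, m \in r -> (x m).+1 < n)%N ->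
  shift_chain x s r G v = iter_sum n r (fun y => chain_kernel x s r y * G y) v.
Proof.
elim: r s v => [|m r IH] s v //= /andP[mr ur] vx xn.
have vr j : j \in r -> v j = x j by move=> jr; apply: vx; rewrite inE jr orbT.
have vur y j : j \in r -> upd v m y j = x j.
  move=> jr; rewrite upd_other ?vr //.
  by apply: contraNneq mr => <-.
have xr j : j \in r -> ((x j).+1 < n)%N by move=> jr; apply: xn; rewrite inE jr orbT.
have xm : ((x m).+1 < n)%N by apply: xn; rewrite mem_head.
transitivity (\sum_(y < n) step s (x m) y (b m) *
    iter_sum n r (fun e => chain_kernel x (moved (x m) y (b m)) r e *
      G e) (upd v m y)); last first.
  apply: eq_bigr => y _.
  have := iter_sum_const (upd v m y) n (fun k => step s (x m) k (b m))
    (fun e => chain_kernel x (moved (x m) y (b m)) r e * G e) mr.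
  rewrite /= upd_same => <-; apply: eq_iter_sum => e eo _.
  have em : e m = y by rewrite eo // upd_same.
  by rewrite em mulrA.
pose X y := step s (x m) y (b m) *
  iter_sum n r (fun e => chain_kernel x (moved (x m) y (b m)) r e * G e) (upd v m y).
rewrite -(big_mkord xpredT X) [in RHS]/index_iota subn0.
have X0 y : y \notin x m :: neighbours (x m) -> X y = 0.
  rewrite /X /step inE negb_or => /andP[/negbTE -> yn].
  suff -> : (y == (x m).+1) || (x m == y.+1) = false by rewrite mul0r.
  apply/negbTE; move: yn; case: (x m) => [|k] /=; rewrite ?inE ?negb_or.
    by move=> ->.
  by case/andP => yk ->; rewrite eqSS eq_sym.
have -> : \sum_(y <- iota 0 n) X y = \sum_(y <- x m :: neighbours (x m)) X y.
  rewrite (bigID (fun y => y \in x m :: neighbours (x m))) /= [X in _ + X]big1 ?addr0;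
    last first.
    by move=> y; apply: X0.
  rewrite -big_filter; apply: perm_big; apply: uniq_perm.
  - by rewrite filter_uniq // iota_uniq.
  - by case: (x m) => [|k] //=; rewrite !inE; lia.
  move=> y; rewrite mem_filter mem_iota add0n /=.
  case: (boolP (y \in x m :: neighbours (x m))) => //= yin.
  by apply: leq_trans xm; move: yin; case: (x m) => [|k]; rewrite !inE; lia.
rewrite big_cons [RHS]addrC; congr (_ + _); last first.
  by rewrite /X /step eqxx IH // -(vx m) ?mem_head // upd_id.
rewrite big_seq [RHS]big_seq; apply: eq_bigr => y yin.
rewrite IH //; last exact: vur.
rewrite /X /step.
have -> : y == x m = false.
  by move: yin; case: (x m) => [|k]; rewrite !inE; lia.
suff -> : (y == (x m).+1) || (x m == y.+1) by [].
by move: yin; case: (x m) => [|k]; rewrite !inE; lia.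
Qed.

Definition adj (x y : nat) := [|| y == x, y == x.+1 | x == y.+1].

Lemma adjP (x y : nat) : reflect [\/ y = x, y = x.+1 | x = y.+1] (adj x y).
Proof.
apply: (iffP or3P) => [] [] => [/eqP|/eqP|/eqP|->|->|->] ; rewrite ?eqxx;
  by [constructor 1|constructor 2|constructor 3].
Qed.

Lemma moved_adj_le (xl yl : nat) bl : (xl <= yl)%N -> adj xl yl ->
  moved xl yl bl = (yl == xl.+1, xl%:R, bl).
Proof.
move=> le /adjP[->|->|e]; rewrite ?moved_id ?moved_up ?eqxx //.
  by rewrite ltn_eqF.
by move: le; rewrite e ltnn.
Qed.

(** The link weights vanish on moves that would break the order of two
    neighbouring coordinates, so the operator never leaves the lattice domain. *)
Lemma step_cross (xl yl xm ym : nat) (bl bm : K) :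
  adj xl yl -> adj xm ym -> (xl <= xm)%N -> (ym < yl)%N ->
  step (moved xl yl bl) xm ym bm = 0.
Proof.
move=> nl nm le lt; rewrite /step.
have ge : (xl <= yl)%N by move/adjP: nm => [] ?; move/adjP: nl => [] ?; lia.
rewrite (moved_adj_le _ ge nl).
move/adjP: nm => [e|e|e]; subst.
- have -> : yl == xl.+1 by move/adjP: nl => [] ?; lia.
  rewrite eqxx /stay /=; case: eqP => // _.
  have -> : xl = xm by move/adjP: nl => [] ?; lia.
  by rewrite /link subrr !(mul0r, mulr0).
- by exfalso; move/adjP: nl => [] ?; lia.
rewrite ltn_eqF // eqxx orbT moved_down /hop /link.
have [exl|exl] : xl = ym.+1 \/ xl = ym by move/adjP: nl => [] ?; lia.
  rewrite exl (_ : - _ - bm + _ + bm = 0); last by ring.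
  by case: ifP; rewrite !mul0r.
have -> : yl == xl.+1 by move/adjP: nl => [] ?; lia.
by rewrite exl -[ym.+1%:R]natr1 (_ : - _ - bm + _ + bm + 1 = 0) ?mulr0 ?mul0r //; ring.
Qed.

End Grid.

(** * The functional equation of Gamma *)

Section GammaFunction.
Variable R : realType.
Implicit Types (z : R) (n : nat).
Local Open Scope classical_set_scope.

Definition gauss z n : R :=
  n`!%:R * n%:R `^ z / \prod_(k < n.+1) (z + k%:R).

(** The weighted arithmetic-geometric mean inequality, from ln t <= t - 1. *)
Lemma powR_bernoulli (a b z : R) : 0 < a -> 0 < b -> 0 <= z <= 1 ->
  b `^ z * a <= a `^ z * (z * b + (1 - z) * a).
Proof.
move=> a0 b0 /andP[z0 z1].
pose M := z * b + (1 - z) * a.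
have M0 : 0 < M.
  have [z1'|z1'] := ltP z 1.
    by apply: ltr_wpDl; [exact: mulr_ge0 (ltW b0)|apply: mulr_gt0; rewrite ?subr_gt0].
  have -> : M = b by rewrite /M (_ : z = 1) ?subrr ?mul0r ?addr0 ?mul1r //;
    apply/le_anti/andP.
  by [].
have ln_le c : 0 < c -> ln c <= c / M - 1 + ln M.
  move=> c0; rewrite -lerBlDr -ln_div ?posrE //.
  have -> : c / M = 1 + (c / M - 1) by ring.
  rewrite (le_trans (le_ln1Dx _)) ?lexx //.
    by rewrite ltrBrDr addNr divr_gt0.
  by rewrite addrAC subrr add0r.
have key : z * ln b + (1 - z) * ln a <= ln M.
  apply: (@le_trans _ _ (z * (b / M - 1 + ln M) + (1 - z) * (a / M - 1 + ln M))).
    apply: lerD; apply: ler_wpM2l; rewrite ?ln_le ?subr_ge0 //.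
  have -> : z * (b / M - 1 + ln M) + (1 - z) * (a / M - 1 + ln M) =
     M / M - 1 + ln M by rewrite /M; ring.
  by rewrite divff ?gt_eqF // subrr add0r.
rewrite -/M -[X in _ * X <= _](lnK (x := a)) ?posrE //.
rewrite -[X in _ <= _ * X](lnK (x := M)) ?posrE //.
rewrite /powR !gt_eqF // -!expRD ler_expR.
by move: key; rewrite mulrBl mul1r; lra.
Qed.

Lemma gauss_den_neq0 z n : ~ Gamma_pole z -> \prod_(k < n) (z + k%:R) != 0.
Proof.
move=> pz; apply/prodf_neq0 => k _; apply/eqP => e; apply: pz.
by exists k; rewrite -[LHS](addrK k%:R) e sub0r.
Qed.

Lemma gaussS_ratio z n : (0 < n)%N -> ~ Gamma_pole z ->
  gauss z n.+1 =
  gauss z n * (n.+1%:R / (z + n.+1%:R)) * (n.+1%:R `^ z / n%:R `^ z).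
Proof.
move=> n0 pz; rewrite /gauss big_ord_recr /= factS natrM.
have d0 := gauss_den_neq0 n.+1 pz.
have := gauss_den_neq0 n.+2 pz; rewrite big_ord_recr /= mulf_eq0 negb_or => /andP[_ d1].
have p0 : n%:R `^ z != 0 :> R by rewrite lt0r_neq0 // powR_gt0 // ltr0n.
by field; rewrite nat1r p0 d1 d0.
Qed.

Lemma gauss_shift z n : ~ Gamma_pole z ->
  gauss (z + 1) n = z * (n%:R / (z + n.+1%:R)) * gauss z n.
Proof.
move=> pz.
have z1 : z + 1 != 0.
  by apply/eqP => e; apply: pz; exists 1%N; rewrite -[LHS](addrK 1) e sub0r.
case: n => [|n].
  by rewrite /gauss powR0 // !(mulr0, mul0r).
have d0 := gauss_den_neq0 n.+2 pz.
have e : z * \prod_(k < n.+2) (z + 1 + k%:R) =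
    (\prod_(k < n.+2) (z + k%:R)) * (z + n.+2%:R).
  transitivity (\prod_(k < n.+3) (z + k%:R)); last by rewrite big_ord_recr.
  rewrite [RHS]big_ord_recl /= addr0; congr (_ * _).
  by apply: eq_bigr => k _; rewrite -addrA nat1r.
have := gauss_den_neq0 n.+3 pz; rewrite big_ord_recr /= mulf_eq0 negb_or => /andP[_ d1].
have d2 : \prod_(k < n.+2) (z + 1 + k%:R) != 0.
  by apply: contraNneq (mulf_neq0 d0 d1) => e0; rewrite -e e0 mulr0.
have z0 : z != 0 by apply: contraNneq (mulf_neq0 d0 d1) => e0; rewrite -e e0 mul0r.
have -> : z + n.+2%:R = z * \prod_(k < n.+2) (z + 1 + k%:R) /
    \prod_(k < n.+2) (z + k%:R) by rewrite e mulrAC mulfV // mul1r.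
rewrite /gauss powRD ?powRr1 ?ler0n //; last by rewrite pnatr_eq0 implybT.
by field; rewrite d0 d2.
Qed.

(** By Bernoulli's inequality the sequence increases from its second term on,
    and its product with (n + z) / n decreases. *)
Lemma gauss_cvg01 z : 0 < z <= 1 -> cvgn (gauss z).
Proof.
move=> /andP[z0 z1].
have pz : ~ Gamma_pole z.
  by move=> [m e]; move: z0; rewrite e oppr_gt0 ltNge ler0n.
have g0 n : 0 <= gauss z n.
  rewrite /gauss divr_ge0 ?mulr_ge0 ?powR_ge0 ?ler0n //.
  by apply: prodr_ge0 => k _; rewrite addr_ge0 ?ler0n // ltW.
have zi : 0 <= z <= 1 by rewrite ltW.
(* h is decreasing and dominates the sequence. *)
pose h n := gauss z n.+1 * ((n.+1%:R + z) / n.+1%:R).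
have hd n : h n.+1 <= h n.
  rewrite /h gaussS_ratio // -!(mulrA (gauss _ _)); apply: ler_wpM2l => //.
  set N := n.+1%:R : R; have N0 : 0 < N by rewrite ltr0n.
  have -> : n.+2%:R = N + 1 by rewrite /N natr1.
  have p0 : 0 < N `^ z by rewrite powR_gt0.
  have -> : (N + 1) / (z + (N + 1)) * ((N + 1) `^ z / N `^ z) * ((N + 1 + z) / (N + 1))
     = (N + 1) `^ z / N `^ z.
    by field; rewrite !gt_eqF //; lra.
  rewrite ler_pdivrMr // mulrAC ler_pdivlMr // mulrC.
  have := powR_bernoulli N0 (_ : 0 < N + 1) zi.
  move=> /(_ ltac:(lra)); rewrite (_ : z * (N + 1) + (1 - z) * N = N + z); last by ring.
  by rewrite [N * _]mulrC [_ * N `^ z]mulrC.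
have gi n : gauss z n.+1 <= gauss z n.+2.
  rewrite (@gaussS_ratio z n.+1) // -!(mulrA (gauss _ _)).
  apply: ler_peMr => //.
  set N := n.+1%:R : R; have N0 : 0 < N by rewrite ltr0n.
  have -> : n.+2%:R = N + 1 by rewrite /N natr1.
  have p0 : 0 < N `^ z by rewrite powR_gt0.
  have p1 : 0 < (N + 1) `^ z by rewrite powR_gt0 //; lra.
  rewrite mulrA ler_pdivlMr // mul1r mulrAC ler_pdivlMr; last by lra.
  have := @powR_bernoulli (N + 1) N z _ N0 zi => /(_ ltac:(lra)).
  rewrite (_ : z * N + (1 - z) * (N + 1) = N + 1 - z); last by ring.
  move=> le1; nra.
apply/cvg_ex.
have : cvgn [sequence gauss z n.+1]_n.
  apply: nondecreasing_is_cvgn; first exact/nondecreasing_seqP.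
  exists (h 0%N) => _ [n _ <-] /=.
  apply: (@le_trans _ _ (h n)).
    rewrite /h ler_peMr // ler_pdivlMr ?ltr0n // mul1r lerDl ltW //.
  by elim: n => [|n IH] //; apply: le_trans (hd n) IH.
by move=> /cvg_ex[l]; rewrite cvg_shiftS => ?; exists l.
Qed.

Lemma gauss_ratio_cvg z :
  (fun n => n%:R / (z + n.+1%:R) : R) @ \oo --> (1 : R).
Proof.
have -> : (fun n => n%:R / (z + n.+1%:R) : R) =
    (fun n => (1 - harmonic n) / (1 + z * harmonic n)).
  apply/funext => n; rewrite /harmonic.
  have n0 : n.+1%:R != 0 :> R by rewrite pnatr_eq0.
  have -> : 1 - n.+1%:R^-1 = n%:R / n.+1%:R :> R.
    by rewrite -[n%:R](addrK 1) natr1 mulrBl divff // mul1r.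
  have -> : 1 + z / n.+1%:R = (z + n.+1%:R) / n.+1%:R by rewrite mulrDl divff // addrC.
  by rewrite invf_div mulrA divfK.
have h0 := @cvg_harmonic R.
have c1 (c : R) : (fun=> c) @ \oo --> c by exact: cvg_cst.
have d0 : 1 + z * 0 != 0 :> R by rewrite mulr0 addr0 oner_neq0.
have := cvgM (cvgB (c1 1) h0) (cvgV d0 (cvgD (c1 1) (cvgM (c1 z) h0))).
rewrite mulr0 addr0 subr0 divr1; exact.
Qed.

Lemma gauss_cvg_up z : ~ Gamma_pole z -> cvgn (gauss z) ->
  gauss (z + 1) @ \oo --> z * limn (gauss z).
Proof.
move=> pz cz.
have -> : gauss (z + 1) = (fun n => z * (n%:R / (z + n.+1%:R)) * gauss z n).
  by apply/funext => n; apply: gauss_shift.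
apply: cvgM => //; rewrite -[X in _ --> X]mulr1.
by apply: (cvgM (cvg_cst z) (@gauss_ratio_cvg z)); exact: eventually_filter.
Qed.

Lemma pole_up z : ~ Gamma_pole z -> ~ Gamma_pole (z + 1).
Proof.
move=> pz [m e]; apply: pz; exists m.+1.
by rewrite -[LHS](addrK 1) e -natr1 opprD.
Qed.

Lemma pole_neq0 z : ~ Gamma_pole z -> z != 0.
Proof. by move=> pz; apply/eqP => z0; apply: pz; exists 0%N; rewrite oppr0. Qed.

Lemma gauss_cvg_down z : ~ Gamma_pole z -> cvgn (gauss (z + 1)) -> cvgn (gauss z).
Proof.
move=> pz /cvg_ex[l cz]; apply/cvg_ex; exists (l / z / 1).
apply: (@cvg_trans _ ((fun n => gauss (z + 1) n / z / (n%:R / (z + n.+1%:R))) @ \oo)).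
  apply: near_eq_cvg; near=> n.
  have n0 : n%:R != 0 :> R by rewrite pnatr_eq0 -lt0n; near: n; exists 1%N.
  rewrite gauss_shift // mulrAC [z * _]mulrC.
  have d1 : z + n.+1%:R != 0.
    by apply/eqP => e; apply: pz; exists n.+1; rewrite -[LHS](addrK n.+1%:R) e sub0r.
  by have z0 := pole_neq0 pz; field; rewrite nat1r d1 z0 n0.
by apply: (cvgM (cvgM cz (cvg_cst z^-1)) (cvgV (oner_neq0 _) (@gauss_ratio_cvg z))).
Unshelve. all: by end_near.
Qed.

(** The shift by 1 in the argument propagates convergence from (0, 1] to every
    real number that is not a pole, upwards and then downwards. *)
Lemma gauss_cvg z : ~ Gamma_pole z -> cvgn (gauss z).
Proof.
have up n : forall y, 0 < y <= n.+1%:R -> cvgn (gauss y).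
  elim: n => [|n IH] y /andP[y0 yn]; first by apply: gauss_cvg01; rewrite y0.
  have [y1|y1] := leP y 1; first by apply: gauss_cvg01; rewrite y0.
  rewrite -(subrK 1 y); apply/cvg_ex; eexists; apply: gauss_cvg_up.
    by move=> [m e]; move: y1; rewrite -subr_gt0 e oppr_gt0 ltNge ler0n.
  by apply: IH; rewrite subr_gt0 y1 lerBlDr natr1.
have pos y : 0 < y -> cvgn (gauss y).
  move=> y0; apply: (up (Num.bound y)); rewrite y0 /= -natr1.
  by rewrite (le_trans (ltW (archi_boundP (ltW y0)))) // lerDl.
have down n : forall y, - n%:R < y -> ~ Gamma_pole y -> cvgn (gauss y).
  elim: n => [|n IH] y yn py; first by apply: pos; rewrite -oppr0.
  apply: gauss_cvg_down => //; apply: IH; last exact: pole_up.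
  by rewrite -ltrBlDr -opprD natr1.
apply: (down (Num.bound `|z|)); rewrite ltrNl.
by rewrite (le_lt_trans (ler_norm _)) // normrN archi_boundP.
Qed.

Lemma GammaS z : ~ Gamma_pole z -> Gamma (z + 1) = z * Gamma z.
Proof.
move=> pz; have := gauss_cvg_up pz (gauss_cvg pz).
by move/cvg_lim => H; rewrite /Gamma [LHS]H.
Qed.

Lemma Gamma_pole0 z : Gamma_pole z -> Gamma z = 0.
Proof.
move=> [m e]; rewrite /Gamma; apply: cvg_lim => //.
apply: (@cvg_trans _ ((fun n : nat => 0 : R) @ \oo)); last exact: cvg_cst.
apply: near_eq_cvg; near=> n.
have mn : (m < n.+1)%N by rewrite ltnS; near: n; exists m.
by rewrite (bigD1 (Ordinal mn)) //= e addNr mul0r invr0 mulr0.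
Unshelve. all: by end_near.
Qed.

(** At the poles both sides are 0. *)
Lemma invGammaS z : (Gamma z)^-1 = z / Gamma (z + 1).
Proof.
have [[m e]|pz] := pselect (Gamma_pole z); last first.
  rewrite GammaS // invfM mulrA divff ?mul1r //; exact: pole_neq0.
rewrite Gamma_pole0; last by exists m.
case: m e => [->|m e]; first by rewrite oppr0 mul0r invr0.
rewrite (@Gamma_pole0 (z + 1)) ?invr0 ?mulr0 //.
by exists m; rewrite e -natr1 opprD addrNK.
Qed.

End GammaFunction.

(** * Detailed balance *)

Section Balance.
Variable R : realType.
Implicit Types (a c : nat) (bl bm : R).

(** The factor of the Racah weight that belongs to two consecutive sites. *)
Definition pair_weight a bl c bm : R :=
  Gamma (bm - bl + c%:R - a%:R) * Gamma (bm + c%:R + a%:R) /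
  ((c - a)`!%:R * Gamma (bl + 1 + c%:R + a%:R)).

Definition regular a bl c bm :=
  ~ Gamma_pole (bm - bl + c%:R - a%:R) /\ ~ Gamma_pole (bm + c%:R + a%:R).

Lemma invGamma2 (x z : R) : x = z + 1 -> (Gamma z)^-1 = z / Gamma x.
Proof. by move=> ->; exact: invGammaS. Qed.

Lemma Gamma2 (x z : R) : x = z + 1 -> ~ Gamma_pole z -> Gamma x = z * Gamma z.
Proof. by move=> ->; exact: GammaS. Qed.

Lemma fact_neq0 n : n`!%:R != 0 :> R.
Proof. by rewrite pnatr_eq0 -lt0n fact_gt0. Qed.

Lemma sym_0p a c bl bm : (a <= c)%N -> regular a bl c bm ->
  pair_weight a bl c bm * link (false, a%:R, bl) (true, c%:R, bm) =
  pair_weight a bl c.+1 bm * link (false, a%:R, bl) (true, - c.+1%:R - bm, bm).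
Proof.
move=> ac [p1 p2]; rewrite /pair_weight subSn // factS natrM -[c.+1%:R]natr1 -(natr1 (c
  - a)).
rewrite (natrB _ ac) !invfM.
rewrite (@Gamma2 (bm - bl + (c%:R + 1) - a%:R) _ _ p1); last by ring.
rewrite (@Gamma2 (bm + (c%:R + 1) + a%:R) _ _ p2); last by ring.
rewrite (@invGamma2 (bl + 1 + (c%:R + 1) + a%:R) (bl + 1 + c%:R + a%:R)); last by ring.
have n1 : c%:R - a%:R + 1 != 0 :> R by rewrite -natrB // natr1 pnatr_eq0.
have nf := fact_neq0 (c - a).
move: (Gamma _)^-1 (Gamma _) (Gamma _) ((c - a)`!%:R) nf => g3 g1 g2 F nf.
by rewrite /link; field; rewrite nf n1.
Qed.

Lemma sym_p0 a c bl bm : (a.+1 <= c)%N -> regular a.+1 bl c bm -> regular a bl c bm ->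
  pair_weight a bl c bm * link (true, a%:R, bl) (false, c%:R, bm) =
  pair_weight a.+1 bl c bm * link (true, - a.+1%:R - bl, bl) (false, c%:R, bm).
Proof.
move=> ac [p1 _] [_ p2]; rewrite /pair_weight.
have -> : (c - a)%N = (c - a.+1).+1 by rewrite subnSK.
rewrite factS natrM -(natr1 (c - a.+1)) (natrB _ ac).
move: p1; rewrite -[a.+1%:R]natr1 => p1 ; rewrite !invfM.
rewrite (@Gamma2 (bm - bl + c%:R - a%:R) _ _ p1); last by ring.
rewrite (@Gamma2 (bm + c%:R + (a%:R + 1)) _ _ p2); last by ring.
rewrite (@invGamma2 (bl + 1 + c%:R + (a%:R + 1)) (bl + 1 + c%:R + a%:R)); last by ring.
have n1 : c%:R - (a%:R + 1) + 1 != 0 :> R.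
  by rewrite opprD addrA subrK -natrB ?(ltnW ac) // pnatr_eq0 subn_eq0 -ltnNge.
have nf := fact_neq0 (c - a.+1).
move: (Gamma _)^-1 (Gamma _) (Gamma _) ((c - a.+1)`!%:R) nf => g3 g1 g2 F nf.
by rewrite /link; field; rewrite nf n1.
Qed.

Lemma sym_pp a c bl bm : (a <= c)%N -> regular a bl c bm ->
  pair_weight a bl c bm * link (true, a%:R, bl) (true, c%:R, bm) =
  pair_weight a.+1 bl c.+1 bm * link (true, - a.+1%:R - bl, bl) (true, - c.+1%:R - bm,
    bm).
Proof.
move=> ac [p1 p2]; rewrite /pair_weight subSS -[a.+1%:R]natr1 -[c.+1%:R]natr1 !invfM.
rewrite (_ : bm - bl + (c%:R + 1) - (a%:R + 1) = bm - bl + c%:R - a%:R); last by ring.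
have p3 := pole_up p2.
rewrite (@Gamma2 (bm + (c%:R + 1) + (a%:R + 1)) _ _ p3); last by ring.
rewrite (@Gamma2 (bm + c%:R + a%:R + 1) _ _ p2) //.
rewrite (@invGamma2 (bl + 1 + c%:R + a%:R + 1) (bl + 1 + c%:R + a%:R)) //.
rewrite (@invGamma2 (bl + 1 + (c%:R + 1) + (a%:R + 1)) (bl + 1 + c%:R + a%:R + 1));
  last by ring.
have nf := fact_neq0 (c - a).
move: (Gamma _)^-1 (Gamma _) (Gamma _) ((c - a)`!%:R) nf => g3 g1 g2 F nf.
by rewrite /link; field; rewrite nf.
Qed.

Lemma sym_pm a c bl bm : (a.+1 <= c)%N -> regular a.+1 bl c bm ->
  pair_weight a bl c.+1 bm * link (true, a%:R, bl) (true, - c.+1%:R - bm, bm) =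
  pair_weight a.+1 bl c bm * link (true, - a.+1%:R - bl, bl) (true, c%:R, bm).
Proof.
move=> ac [p1 p2]; rewrite /pair_weight.
have -> : (c.+1 - a)%N = (c - a.+1).+2 by rewrite subSn ?(ltnW ac) // subnSK.
rewrite !factS !natrM -(natr1 (c - a.+1).+1) -(natr1 (c - a.+1)) (natrB _ ac).
move: p1 p2; rewrite -[a.+1%:R]natr1 -[c.+1%:R]natr1 => p1 p2; rewrite !invfM.
have p3 := pole_up p1.
rewrite (@Gamma2 (bm - bl + (c%:R + 1) - a%:R) _ _ p3); last by ring.
rewrite (@Gamma2 (bm - bl + c%:R - (a%:R + 1) + 1) _ _ p1) //.
rewrite (_ : bm + (c%:R + 1) + a%:R = bm + c%:R + (a%:R + 1)); last by ring.
rewrite (_ : bl + 1 + (c%:R + 1) + a%:R = bl + 1 + c%:R + (a%:R + 1)); last by ring.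
have n1 : c%:R - (a%:R + 1) + 1 != 0 :> R.
  by rewrite opprD addrA subrK -natrB ?(ltnW ac) // pnatr_eq0 subn_eq0 -ltnNge.
have n2 : c%:R - (a%:R + 1) + 1 + 1 != 0 :> R.
  by rewrite opprD addrA subrK -natrB ?(ltnW ac) // natr1 pnatr_eq0.
have nf := fact_neq0 (c - a.+1).
move: (Gamma _)^-1 (Gamma _) (Gamma _) ((c - a.+1)`!%:R) nf => g3 g1 g2 F nf.
by rewrite /link; field; rewrite nf n1 n2.
Qed.

(** Detailed balance for one link: the four cases above and their converses.
    Each only compares Gamma factors whose arguments differ by at most 2. *)
Lemma link_sym a a1 c c1 bl bm : (a <= c)%N -> (a1 <= c1)%N -> adj a a1 -> adj c c1 ->
  regular a bl c bm -> regular a1 bl c1 bm ->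
  pair_weight a bl c bm * link (moved a a1 bl) (moved c c1 bm) =
  pair_weight a1 bl c1 bm * link (moved a1 a bl) (moved c1 c bm).
Proof.
move=> ac ac1 /adjP na /adjP nc.
case: na => ea; case: nc => ec; subst; rewrite ?moved_id ?moved_up ?moved_down => r0 r1.
- by [].
- exact: sym_0p.
- by rewrite -sym_0p.
- exact: sym_p0.
- exact: sym_pp.
- by rewrite sym_pm.
- by rewrite -sym_p0.
- by rewrite -sym_pm.
by rewrite -sym_pp.
Qed.

Lemma stay_balance (x y w v b d : R) : x * w = y * v ->
  x * b * (2 * w / d) = y * b * (2 * v / d).
Proof.
move=> e; have -> : x * b * (2 * w / d) = (x * w) * (b * 2 / d) by ring.
by rewrite e; ring.
Qed.

Lemma hop_balance (x y w v b k : R) : 2 * k + b != 0 -> 2 * k + b + 1 != 0 ->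
  2 * (k + 1) + b != 0 -> x * w = y * v ->
  x * (b + 2 * k) * (w / ((2 * k + b) * (2 * k + b + 1))) =
  y * (b + 2 * (k + 1)) *
    (v / ((2 * (- (k + 1) - b) + b) * (2 * (- (k + 1) - b) + b + 1))).
Proof.
move=> n0 n1 n2 e.
have -> : x * (b + 2 * k) * (w / ((2 * k + b) * (2 * k + b + 1))) = x * w / (2 * k +
  b + 1).
  by field; rewrite n0 n1.
rewrite e; have m0 : 2 * (- (k + 1) - b) + b != 0.
  by rewrite (_ : _ + b = - (2 * (k + 1) + b)) ?oppr_eq0 //; ring.
have m1 : 2 * (- (k + 1) - b) + b + 1 != 0.
  by rewrite (_ : _ + 1 = - (2 * k + b + 1)) ?oppr_eq0 //; ring.
by field; rewrite m0 m1 n1.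
Qed.

Lemma step_sym a a1 c c1 bl bm : (forall n, bm != - n%:R) ->
  (a <= c)%N -> (a1 <= c1)%N -> adj a a1 -> adj c c1 ->
  regular a bl c bm -> regular a1 bl c1 bm ->
  pair_weight a bl c bm * (bm + 2 * c%:R) * step (moved a a1 bl) c c1 bm =
  pair_weight a1 bl c1 bm * (bm + 2 * c1%:R) * step (moved a1 a bl) c1 c bm.
Proof.
move=> bn ac ac1 na nc r0 r1; have := link_sym ac ac1 na nc r0 r1.
have nb k : bm + k%:R != 0 by rewrite addr_eq0.
have nb2 k : 2 * k%:R + bm != 0 by rewrite addrC -natrM.
have nb21 k : 2 * k%:R + bm + 1 != 0.
  rewrite (_ : _ + _ = bm + (2 * k).+1%:R) ?nb //.
  by rewrite -(natr1 (2 * k)) natrM; ring.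
rewrite /step; case/adjP: nc => ec; subst.
- rewrite !eqxx !moved_id /stay => e.
  have [c0|c0] := eqVneq c 0%N.
    have -> : a = a1 by move: ac ac1; rewrite c0 !leqn0 => /eqP -> /eqP ->.
    by [].
  exact: stay_balance.
- rewrite moved_up moved_down /hop /site_den /= (ltn_eqF (ltnSn c)) (gtn_eqF (ltnSn c))
  eqxx orbT /=.
  rewrite -[c.+1%:R]natr1 => e; apply: hop_balance => //.
  by rewrite natr1 nb2.
rewrite moved_up moved_down /hop /site_den /= (ltn_eqF (ltnSn c1)) (gtn_eqF (ltnSn c1))
  eqxx orbT /=.
rewrite -[c1.+1%:R]natr1 => e; apply/esym; apply: hop_balance => //.
by rewrite natr1 nb2.
Qed.

Lemma step_far (s : bool * R * R) c c1 bm : ~~ adj c c1 -> step s c c1 bm = 0.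
Proof.
by rewrite /step /adj !negb_or => /and3P[/negbTE -> /negbTE -> /negbTE ->].
Qed.

Lemma adjC c c1 : adj c c1 = adj c1 c.
Proof. by rewrite /adj eq_sym; congr (_ || _); rewrite orbC. Qed.

Section Chain.
Variables (I : eqType) (b : I -> R) (bE : R) (N : nat).
Hypothesis bnat : forall i n, b i != - n%:R.
Implicit Types (x y : I -> nat) (r : seq I).
Let tend : bool * R * R := (false, N%:R, bE).

Fixpoint weight_chain xl bl r x : R :=
  if r is m :: r' then
    pair_weight xl bl (x m) (b m) * (b m + 2 * (x m)%:R) * weight_chain (x m) (b m) r' x
  else pair_weight xl bl N bE.

Fixpoint regular_chain xl bl r x : Prop :=
  if r is m :: r' then regular xl bl (x m) (b m) /\ regular_chain (x m) (b m) r' x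
  else regular xl bl N bE.

(** The weight and the kernel are both products over the links, hence detailed
    balance for a chain follows link by link. *)
Lemma chain_sym xl yl bl r x y : adj xl yl ->
  path leq xl (rcons (map x r) N) -> path leq yl (rcons (map y r) N) ->
  regular_chain xl bl r x -> regular_chain yl bl r y ->
  weight_chain xl bl r x * chain_kernel b tend x (moved xl yl bl) r y =
  weight_chain yl bl r y * chain_kernel b tend y (moved yl xl bl) r x.
Proof.
elim: r xl yl bl => [|m r IH] xl yl bl /=.
  rewrite !andbT => al xN yN rx ry.
  have aN : adj N N by rewrite /adj eqxx.
  by have := link_sym xN yN al aN rx ry; rewrite !moved_id.
move=> al /andP[lx px] /andP[ly py] [rx rx'] [ry ry'].
have [am|nam] := boolP (adj (x m) (y m)); last first.
  by rewrite !step_far ?mul0r ?mulr0 // adjC.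
rewrite mulrACA [RHS]mulrACA (step_sym (bnat m) lx ly al am rx ry).
by congr (_ * _); apply: IH.
Qed.

Lemma chain_kernel_support xl yl bl r x y : adj xl yl ->
  path leq xl (rcons (map x r) N) ->
  chain_kernel b tend x (moved xl yl bl) r y != 0 -> path leq yl (rcons (map y r) N).
Proof.
elim: r xl yl bl => [|m r IH] xl yl bl /=.
  rewrite !andbT => al xN; apply: contraR; rewrite -ltnNge => Ny.
  have xl_le : (xl <= yl)%N by apply: leq_trans xN (ltnW Ny).
  rewrite (moved_adj_le _ xl_le al); have [e1 e2] : xl = N /\ yl = xl.+1.
    by move/adjP: al => [] ?; split; lia.
  by rewrite e2 e1 eqxx /link /tend subrr mul0r eqxx.
move=> al /andP[lx px]; rewrite mulf_eq0 negb_or => /andP[k0 c0].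
have am : adj (x m) (y m).
  by apply: contraNT k0 => nam; rewrite step_far.
rewrite (IH _ _ _ am px c0) andbT leqNgt; apply: contra k0 => lt.
by rewrite (step_cross _ _ al am lx lt).
Qed.

End Chain.
End Balance.

(** * Substitutions, degrees and divided differences *)

Section Poly.
Variables (R : realType) (p : nat).
Local Notation P := {mpoly R[p]}.
Implicit Types (i j : 'I_p) (q f g h : P) (c : R) (v : 'I_p -> R).

Lemma mpoly_subring_ind (S : P -> Prop) :
  (forall c, S c%:MP) -> (forall i, S 'X_i) ->
  (forall f g, S f -> S g -> S (f + g)) ->
  (forall f g, S f -> S g -> S (f * g)) -> forall f, S f.
Proof.
move=> SC SX SD SM f; elim/mpolyind: f => [|c m f _ _ Sf]; first by rewrite -mpolyC0.
apply: (SD) Sf; rewrite -mul_mpolyC; apply: (SM) => //.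
rewrite mpolyXE_id; elim/big_ind: _ => [||i _]; [by rewrite -mpolyC1|exact: SM|].
by elim: (m i) => [|k IH]; rewrite ?expr0 -?mpolyC1 // exprS; apply: (SM).
Qed.

(** Identities between substitutions are checked on the variables only. *)
Lemma mpoly_morph_ext (S : comNzRingType) (F G : {rmorphism P -> S}) :
  (forall c, F c%:MP = G c%:MP) -> (forall i, F 'X_i = G 'X_i) -> F =1 G.
Proof.
move=> eC eX; apply: mpoly_subring_ind => // f g ef eg.
  by rewrite !rmorphD ef eg.
by rewrite !rmorphM ef eg.
Qed.

HB.instance Definition _ i q :=
  GRing.RMorphism.copy (subst_var i q)
    (comp_mpoly [tuple if j == i then q else 'X_j | j < p]).

Lemma subst_varX i q j : subst_var i q 'X_j = if j == i then q else 'X_j.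
Proof. by rewrite /subst_var comp_mpolyXU -tnth_nth tnth_mktuple. Qed.

Lemma subst_varXX i q : subst_var i q 'X_i = q.
Proof. by rewrite subst_varX eqxx. Qed.

Lemma subst_varC i q c : subst_var i q c%:MP = c%:MP.
Proof. exact: comp_mpolyC. Qed.

Definition indep i f := forall q, subst_var i q f = f.

Lemma indepC i c : indep i c%:MP.
Proof. by move=> q; rewrite subst_varC. Qed.

Lemma indepX i j : j != i -> indep i 'X_j.
Proof. by move=> ji q; rewrite subst_varX (negbTE ji). Qed.

Lemma subst_var_comp i q q' f :
  subst_var i q (subst_var i q' f) = subst_var i (subst_var i q q') f.
Proof.
apply: (@mpoly_morph_ext _ (subst_var i q \o subst_var i q')
   (subst_var i (subst_var i q q'))) => [c|j] /=; rewrite ?subst_varC //.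
by rewrite !subst_varX; case: eqVneq => // ji; rewrite subst_varX (negbTE ji).
Qed.

Lemma subst_varAC i j q q' f : i != j -> indep i q' -> indep j q ->
  subst_var i q (subst_var j q' f) = subst_var j q' (subst_var i q f).
Proof.
move=> ij iq' jq.
apply: (@mpoly_morph_ext _ (subst_var i q \o subst_var j q')
   (subst_var j q' \o subst_var i q)) => [c|k] /=; rewrite ?subst_varC //.
rewrite !subst_varX; case: (eqVneq k i) => [->|ki].
  by rewrite (negbTE ij) subst_varXX jq.
case: (eqVneq k j) => [->|kj]; first by rewrite subst_varXX iq'.
by rewrite !subst_varX (negbTE ki) (negbTE kj).
Qed.

Lemma subst_var_id i f : subst_var i 'X_i f = f.
Proof.
apply: (@mpoly_morph_ext _ (subst_var i 'X_i) idfun) => [c|j] /=; rewrite ?subst_varC //.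
by rewrite subst_varX; case: eqP => [->|].
Qed.

Definition refl i c : P -> P := subst_var i (- 'X_i - c%:MP).

HB.instance Definition _ i c :=
  GRing.RMorphism.copy (refl i c) (subst_var i (- 'X_i - c%:MP)).

Lemma reflX i c : refl i c 'X_i = - 'X_i - c%:MP.
Proof. exact: subst_varXX. Qed.

Lemma reflC i c (a : R) : refl i c a%:MP = a%:MP.
Proof. exact: subst_varC. Qed.

Lemma reflK i c : involutive (refl i c).
Proof.
move=> f; rewrite /refl subst_var_comp rmorphB rmorphN /= subst_varXX subst_varC.
by rewrite opprD !opprK addrK subst_var_id.
Qed.

Lemma refl_comm i j c c' f : i != j -> refl i c (refl j c' f) = refl j c' (refl i c f).
Proof.
move=> ij; apply: subst_varAC => // q.
  by rewrite rmorphB rmorphN /= subst_varC indepX // eq_sym.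
by rewrite rmorphB rmorphN /= subst_varC indepX.
Qed.

Lemma refl_shift i c f : refl i (c + 1) (subst_var i ('X_i + 1) f) = refl i c f.
Proof.
rewrite /refl subst_var_comp rmorphD rmorph1 /= subst_varXX.
by congr subst_var; rewrite mpolyCD mpolyC1; ring.
Qed.

Lemma subst_var_meval i q f v :
  (subst_var i q f).@[v] = f.@[fun j => if j == i then q.@[v] else v j].
Proof.
rewrite comp_mpoly_meval; apply: meval_eq => j; rewrite tnth_mktuple.
by case: eqP => // _; rewrite mevalXU.
Qed.

(** The bound is an integer so that degrees can be subtracted freely: the zero
    polynomial satisfies every bound, negative ones included. *)
Definition deg_le (d : int) f := (f == 0) || ((msize f)%:Z <= d + 1).

Lemma deg_le0 d : deg_le d 0.
Proof. by rewrite /deg_le eqxx. Qed.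

Lemma deg_leM a b f g : deg_le a f -> deg_le b g -> deg_le (a + b) (f * g).
Proof.
rewrite /deg_le; have [->|f0] := eqVneq f 0; first by rewrite mul0r eqxx.
have [->|g0] := eqVneq g 0; first by rewrite mulr0 eqxx.
rewrite msizeM //= => fa gb; apply/orP; right.
move: f0 g0; rewrite -!msize_poly_eq0.
by move: (msize f) (msize g) fa gb => x y; lia.
Qed.

Lemma deg_leD a f g : deg_le a f -> deg_le a g -> deg_le a (f + g).
Proof.
rewrite {1 2}/deg_le; have [->|f0] := eqVneq f 0; first by rewrite add0r.
have [->|g0] := eqVneq g 0; first by rewrite addr0 /deg_le => fa _; apply/orP; right;
  exact: fa.
move=> /= fa gb; rewrite /deg_le; apply/orP; right.
have := msizeD_le f g.
by move: (msize f) (msize g) (msize _) fa gb => x y z; lia.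
Qed.

Lemma deg_leN a f : deg_le a (- f) = deg_le a f.
Proof. by rewrite /deg_le msizeN oppr_eq0. Qed.

Lemma deg_leB a f g : deg_le a f -> deg_le a g -> deg_le a (f - g).
Proof. by move=> fa gb; apply: deg_leD; rewrite ?deg_leN. Qed.

Lemma deg_leW a b f : a <= b -> deg_le a f -> deg_le b f.
Proof.
rewrite /deg_le; case: eqP => //= _ ab fa.
by apply: le_trans fa _; rewrite lerD2r.
Qed.

Lemma deg_leC c : deg_le 0 c%:MP.
Proof. by rewrite /deg_le msizeC add0r orbC; case: (c == 0). Qed.

Lemma deg_leCW d c : 0 <= d -> deg_le d c%:MP.
Proof. by move=> d0; apply: deg_leW (deg_leC c). Qed.

Lemma deg_leX i : deg_le 1 'X_i.
Proof. by rewrite /deg_le msizeX mdeg1 orbT. Qed.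

Lemma deg_le1 : deg_le 0 1.
Proof. by rewrite -mpolyC1 deg_leC. Qed.

Lemma deg_leXn a f n : deg_le a f -> deg_le (a * n%:Z) (f ^+ n).
Proof.
move=> fa; elim: n => [|n IH]; first by rewrite mulr0 expr0 deg_le1.
by rewrite exprS intS mulrDr mulr1; apply: deg_leM.
Qed.

Lemma deg_le_sum (T : Type) (r : seq T) (Q : pred T) (F : T -> P) a :
  (forall x, Q x -> deg_le a (F x)) -> deg_le a (\sum_(x <- r | Q x) F x).
Proof. by move=> H; elim/big_ind: _ => //; [exact: deg_le0|exact: deg_leD]. Qed.

Lemma deg_leZ a c f : deg_le a f -> deg_le a (c *: f).
Proof.
by move=> fa; rewrite -mul_mpolyC -[a]add0r; apply: deg_leM => //; exact: deg_leC.
Qed.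

Lemma deg_le_prod (T : Type) (r : seq T) (F : T -> P) (a : T -> int) :
  (forall x, deg_le (a x) (F x)) -> deg_le (\sum_(x <- r) a x) (\prod_(x <- r) F x).
Proof.
move=> H; elim/big_ind2: _ => // [|x1 x2 y1 y2]; last exact: deg_leM.
exact: deg_le1.
Qed.

Lemma deg_le_comp (d : int) (k : nat) f (t : p.-tuple P) :
  (forall i, deg_le k (tnth t i)) -> deg_le d f -> deg_le (k%:Z * d) (f \mPo t).
Proof.
move=> ht; rewrite {1}/deg_le => /orP[/eqP ->|hf].
  by rewrite comp_mpoly0 deg_le0.
rewrite comp_mpolyE big_seq; apply: deg_le_sum => m mf.
apply: deg_leZ; apply: (@deg_leW (\sum_i k%:Z * (m i)%:Z)).
  rewrite -big_distrr /= ler_wpM2l //.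
  have -> : \sum_(i < p) (m i)%:Z = (mdeg m)%:Z.
    by rewrite mdegE -natz natr_sum; apply: eq_bigr => i _; rewrite natz.
  by have := msize_mdeg_lt mf; move: hf; move: (msize f) (mdeg m) => x y; lia.
by apply: deg_le_prod => i; apply: deg_leXn.
Qed.

Lemma deg_le_subst n i q f : deg_le 1 q -> deg_le n f -> deg_le n (subst_var i q f).
Proof.
move=> hq hf; rewrite -[n]mul1r; apply: (@deg_le_comp _ 1%N) => // j.
by rewrite tnth_mktuple; case: ifP => // _; exact: deg_leX.
Qed.

Lemma deg_le_refl n i c f : deg_le n f -> deg_le n (refl i c f).
Proof.
apply: deg_le_subst; apply: deg_leB; rewrite ?deg_leN; first exact: deg_leX.
exact: deg_leCW.
Qed.

(** The linear form that vanishes on the hyperplane fixed by [refl i c]. *)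
Definition axis i c : P := 2 * 'X_i + c%:MP.

Lemma axis_meval i c v : (axis i c).@[v] = 2 * v i + c.
Proof. by rewrite /axis mevalD mevalM mevalXU mevalC rmorph_nat. Qed.

Lemma axis_neq0 i c : axis i c != 0.
Proof.
apply/eqP => e; have := axis_meval i c (fun=> (1 - c) / 2).
rewrite e meval0 mulrC divfK ?pnatr_eq0 // subrK => /esym/eqP.
by rewrite oner_eq0.
Qed.

Lemma refl_axis i c : refl i c (axis i c) = - axis i c.
Proof. rewrite rmorphD rmorphM rmorph_nat /= reflX reflC /axis; ring. Qed.

(** A polynomial that is antisymmetric under a reflection vanishes on its fixed
    hyperplane; by the Leibniz rule it is enough to look at the generators. *)
Lemma divdiff_exists i c h : exists g, axis i c * g = h - refl i c h.
Proof.
move: h; apply: mpoly_subring_ind => [a|j|f g [f' ef] [g' eg]|f g [f' ef] [g' eg]].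
- by exists 0; rewrite mulr0 reflC subrr.
- have [->|ji] := eqVneq j i.
    by exists 1; rewrite mulr1 reflX /axis; ring.
  by exists 0; rewrite mulr0 /refl indepX // subrr.
- by exists (f' + g'); rewrite mulrDr ef eg rmorphD; ring.
by exists (f' * g + refl i c f * g'); rewrite mulrDr mulrA ef mulrCA eg rmorphM; ring.
Qed.

(** The Demazure-type divided difference of the reflection. *)
Definition divdiff i c h : P := xget 0 [set g | axis i c * g = h - refl i c h]%classic.

Lemma divdiffE i c h : axis i c * divdiff i c h = h - refl i c h.
Proof.
by have [g eg] := divdiff_exists i c h; rewrite /divdiff; case: xgetP => // /(_ g).
Qed.

Lemma divdiff_uniq i c h g : axis i c * g = h - refl i c h -> divdiff i c h = g.
Proof.
by rewrite -divdiffE => /(mulfI (axis_neq0 i c)).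
Qed.

Lemma divdiff_is_additive i c : zmod_morphism (divdiff i c).
Proof.
move=> f g; apply: divdiff_uniq; rewrite mulrBr !divdiffE rmorphB; ring.
Qed.
HB.instance Definition _ i c := GRing.isZmodMorphism.Build P P (divdiff i c)
  (divdiff_is_additive i c).

Lemma divdiff_mull i c a h : refl i c a = a -> divdiff i c (a * h) = a * divdiff i c h.
Proof.
by move=> ra; apply: divdiff_uniq; rewrite mulrCA divdiffE rmorphM /= ra mulrBr.
Qed.

Lemma refl_divdiff i c h : refl i c (divdiff i c h) = divdiff i c h.
Proof.
apply/esym/divdiff_uniq/oppr_inj; rewrite -mulNr -refl_axis -rmorphM /= divdiffE
  rmorphB /= reflK; ring.
Qed.

Lemma refl_divdiff_comm i j c c' h : j != i -> refl j c' (divdiff i c h) =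
  divdiff i c (refl j c' h).
Proof.
move=> ji; apply/esym/divdiff_uniq; rewrite refl_comm 1?eq_sym // -rmorphB -divdiffE
  rmorphM /=.
by congr (_ * _); rewrite /axis rmorphD rmorphM rmorph_nat /= reflC /refl indepX //
  eq_sym.
Qed.

Lemma subst_divdiff_comm i j q c h : j != i -> indep i q ->
  subst_var j q (divdiff i c h) = divdiff i c (subst_var j q h).
Proof.
move=> ji iq; apply/esym/divdiff_uniq.
rewrite /refl (@subst_varAC i j) 1?eq_sym //; last first.
  by move=> q'; rewrite rmorphB rmorphN /= subst_varC indepX // eq_sym.
rewrite -rmorphB -divdiffE rmorphM /=.
by congr (_ * _); rewrite /axis rmorphD rmorphM rmorph_nat /= subst_varC indepX // eq_sym.
Qed.

Lemma divdiff_even i c h : refl i c h = h -> divdiff i c h = 0.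
Proof. by move=> e; apply: divdiff_uniq; rewrite e mulr0 subrr. Qed.

Lemma deg_le_axis i c f d : deg_le (d + 1) (axis i c * f) -> deg_le d f.
Proof.
have [->|f0] := eqVneq f 0; first by rewrite deg_le0.
rewrite /deg_le mulf_eq0 (negbTE (axis_neq0 i c)) (negbTE f0) /=.
rewrite msizeM ?axis_neq0 // => le.
suff : (1 < msize (axis i c))%N.
  by move: le; move: (msize _) (msize _) => x y; lia.
rewrite ltnNge; apply/negP => /msize1_polyC e.
have := axis_meval i c (fun=> 1); have := axis_meval i c (fun=> 0).
by rewrite e !mevalC => ->; lra.
Qed.

Lemma deg_le_divdiff d i c h : deg_le (d + 1) h -> deg_le d (divdiff i c h).
Proof.
move=> hn; apply: (@deg_le_axis i c); rewrite divdiffE.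
by apply: deg_leB => //; apply: deg_le_refl.
Qed.

Lemma divdiff_meval i c h v : 2 * v i + c != 0 ->
  (divdiff i c h).@[v] =
  (h.@[v] - h.@[fun j => if j == i then - v i - c else v j]) / (2 * v i + c).
Proof.
move=> n0; apply: (mulfI n0); rewrite mulrC [RHS]mulrC divfK // mulrC.
rewrite -axis_meval -mevalM divdiffE mevalB; congr (_ - _).
by rewrite subst_var_meval mevalB mevalN mevalXU mevalC.
Qed.

End Poly.

(** * The chain operator on polynomials *)

Section Operator.
Variables (R : realType) (p : nat) (b : 'I_p -> R) (bE : R) (N : nat).
Local Notation P := {mpoly R[p]}.
Implicit Types (i j m l : 'I_p) (q f g h : P) (c : R) (v : 'I_p -> R).
Implicit Types (s : bool * P * P) (r : seq 'I_p).

Definition end_state : bool * P * P := (false, N%:R, bE%:MP).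
Definition site_state i : bool * P * P := (true, 'X_i, (b i)%:MP).
(** For a reflection-invariant f this is the forward difference divided by
    2 x_i + b_i + 1 (lemma [divstep_axis]): then f (x + e_i) is sent to f by the
    reflection x_i -> - x_i - b_i - 1, so the division is exact. *)
Definition divstep i f : P := divdiff i (b i + 1) (subst_var i ('X_i + 1) f).

(** The sum over subsets of [r] and over reflections of the terms A_nu Delta f,
    organised site by site.  For each site m of the subset, the sum of
    h / (2 x_m + b_m) and its reflection is a divided difference of h, and the
    factor 2 x_m + b_m + 1 is absorbed by [divstep], hence the result is a
    polynomial.
    An unmoved left end stands for the site 0, and dropping the term of the
    empty subset explains the value 0. *)
Fixpoint chain_op s r f : P :=
  if r is m :: r' then
    divdiff m (b m) (link s (site_state m) * chain_op (site_state m) r' (divstep m f))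
      + chain_op s r' f
  else if s.1.1 then link s end_state * f else 0.

Lemma link_morph (S : comUnitRingType) (S' : comUnitRingType) (F : {rmorphism S -> S'})
    (s t : bool * S * S) : s.1.1 || t.1.1 ->
  F (link s t) = link (s.1.1, F s.1.2, F s.2) (t.1.1, F t.1.2, F t.2).
Proof.
case: s => [[a yl] bl]; case: t => [[a' ym] bm].
by case: a; case: a' => //= _;
  rewrite /link /= ?(rmorphM, rmorphD, rmorphB, rmorphN, rmorph1).
Qed.

Lemma divstep_is_additive i : zmod_morphism (divstep i).
Proof. by move=> f g; rewrite /divstep !raddfB. Qed.
HB.instance Definition _ i := GRing.isZmodMorphism.Build P P (divstep i)
  (divstep_is_additive i).

Lemma chain_op_is_additive s r : zmod_morphism (chain_op s r).
Proof.
elim: r s => [|m r IH] s f g /=.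
  by case: ifP => _; rewrite ?subr0 // mulrBr.
rewrite (IH s f g) (raddfB (divstep m) f g) (IH _ (divstep m f) (divstep m g)) mulrBr.
by rewrite (raddfB (divdiff m (b m))) opprD addrACA.
Qed.
HB.instance Definition _ s r := GRing.isZmodMorphism.Build P P (chain_op s r)
  (chain_op_is_additive s r).

Definition indeps r h := forall j, j \in r -> indep j h.

Lemma divstep_mull i h f : indep i h -> divstep i (h * f) = h * divstep i f.
Proof. by move=> ih; rewrite /divstep rmorphM /= ih divdiff_mull // /refl ih. Qed.

Lemma chain_op_mull s r h f : indeps r h -> chain_op s r (h * f) = h * chain_op s r f.
Proof.
elim: r s f => [|m r IH] s f ih /=.
  by case: ifP => _; rewrite ?mulr0 // mulrCA.
have im : indep m h by apply: ih; rewrite mem_head.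
have ir : indeps r h by move=> j jr; apply: ih; rewrite inE jr orbT.
by rewrite divstep_mull // !IH // mulrCA divdiff_mull ?mulrDr // /refl im.
Qed.

Lemma subst_divstep i j q f : j != i -> indep i q ->
  subst_var j q (divstep i f) = divstep i (subst_var j q f).
Proof.
move=> ji iq; rewrite /divstep (subst_divdiff_comm _ _ ji iq); congr divdiff.
by apply: subst_varAC => // q'; rewrite rmorphD rmorph1 /= indepX // eq_sym.
Qed.

Lemma refl_divstep i j c f : j != i -> refl j c (divstep i f) = divstep i (refl j c f).
Proof.
move=> ji; apply: subst_divstep => // q.
by rewrite rmorphB rmorphN /= subst_varC indepX.
Qed.

Lemma divstep_axis i f : refl i (b i) f = f ->
  axis i (b i + 1) * divstep i f = subst_var i ('X_i + 1) f - f.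
Proof. by move=> rf; rewrite divdiffE refl_shift rf. Qed.

(** Divided differences are invariant under their own reflection. *)
Lemma chain_op_refl s r f j : refl j (b j) s.1.2 = s.1.2 -> refl j (b j) s.2 = s.2 ->
  refl j (b j) f = f -> refl j (b j) (chain_op s r f) = chain_op s r f.
Proof.
elim: r s f => [|m r IH] s f s1 s2 rf /=.
  case: ifP => sa; rewrite ?rmorph0 // rmorphM /= rf link_morph ?sa //= rmorph_nat
    reflC s1 s2.
  by case: s sa {s1 s2} => [[a yl] bl] /= ->.
rewrite rmorphD /= (IH _ _ s1 s2 rf); congr (_ + _).
have [->|jm] := eqVneq j m; first by rewrite refl_divdiff.
rewrite (refl_divdiff_comm _ _ _ jm) rmorphM /= link_morph ?orbT //= reflC s1 s2.
have jX : refl j (b j) 'X_m = 'X_m by apply: indepX; rewrite eq_sym.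
rewrite jX IH /=; [|exact: jX|exact: reflC|by rewrite (refl_divstep _ _ jm) rf].
by case: s {s1 s2} => [[a yl] bl].
Qed.

(** The centred variable: reflections change its sign, lambda_i is its square up
    to a constant, and leading terms are visible in it. *)
Definition cvar i : P := 'X_i + (b i / 2)%:MP.

Lemma refl_cvar i : refl i (b i) (cvar i) = - cvar i.
Proof.
rewrite /cvar rmorphD /= reflX reflC {1}(splitr (b i)) mpolyCD; ring.
Qed.

Lemma axis_cvar i : axis i (b i) = 2 * cvar i.
Proof. rewrite /axis /cvar {1}(splitr (b i)) mpolyCD; ring. Qed.

Lemma axis_cvar1 i : axis i (b i + 1) = 2 * cvar i + 1.
Proof. by rewrite -axis_cvar /axis mpolyCD mpolyC1 addrA. Qed.

Lemma indep_cvar i j : j != i -> indep i (cvar j).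
Proof. by move=> ji q; rewrite /cvar rmorphD /= subst_varC indepX. Qed.

Lemma refl_indep i c h : indep i h -> refl i c h = h.
Proof. by move=> ih; rewrite /refl ih. Qed.

Lemma shift_cvar i : subst_var i ('X_i + 1) (cvar i) = cvar i + 1.
Proof. by rewrite /cvar rmorphD /= subst_varXX subst_varC addrAC. Qed.

Lemma deg_cvar i : deg_le 1 (cvar i).
Proof. by apply: deg_leD; [exact: deg_leX|exact: deg_leCW]. Qed.

Lemma deg_cvarX i n : deg_le n%:Z (cvar i ^+ n).
Proof. by have := deg_leXn n (deg_cvar i); rewrite mul1r. Qed.

Lemma refl_cvarX2 i n : refl i (b i) (cvar i ^+ (2 * n)) = cvar i ^+ (2 * n).
Proof. by rewrite rmorphXn /= refl_cvar !exprM sqrrN. Qed.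

Lemma divdiff_cvarXodd i n h : refl i (b i) h = h ->
  divdiff i (b i) (h * cvar i ^+ (2 * n).+1) = h * cvar i ^+ (2 * n).
Proof.
move=> rh; apply: divdiff_uniq; rewrite axis_cvar rmorphM /= rh exprS rmorphM /=
  refl_cvar refl_cvarX2.
ring.
Qed.

Lemma divdiff_cvarXeven i n h : refl i (b i) h = h -> divdiff i (b i) (h *
  cvar i ^+ (2 * n)) = 0.
Proof. by move=> rh; apply: divdiff_even; rewrite rmorphM /= rh refl_cvarX2. Qed.

Lemma divstep_cvarX0 i : divstep i (cvar i ^+ (2 * 0)) = 0.
Proof. by apply: divdiff_uniq; rewrite !rmorph1 mulr0 subrr. Qed.

Lemma divstep_cvarXS i k : divstep i (cvar i ^+ (2 * k.+1)) =
  (cvar i + 1) ^+ 2 * divstep i (cvar i ^+ (2 * k)) + cvar i ^+ (2 * k).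
Proof.
apply: (mulfI (axis_neq0 i (b i + 1))).
rewrite divstep_axis ?refl_cvarX2 // mulrDr mulrCA divstep_axis ?refl_cvarX2 //
  axis_cvar1.
rewrite !rmorphXn /= shift_cvar mulnS !exprD; ring.
Qed.

Lemma cvarX_pred i k : k%:R * cvar i ^+ (2 * k).-1 * cvar i = k%:R * cvar i ^+ (2 * k).
Proof.
case: k => [|k]; first by rewrite !mul0r.
by rewrite -mulrA -exprSr mulnS.
Qed.

(** Two leading terms of ((u + 1)^(2 k + 2) - u^(2 k + 2)) / (2 u + 1), by the
    recurrence [divstep_cvarXS].  For k = 0 the exponent (2 k).-1 is
    meaningless, but its coefficient is 0. *)
Lemma divstep_lead i k : exists2 g, deg_le (2 * k%:Z - 2) g &
  divstep i (cvar i ^+ (2 * k.+1)) =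
  k.+1%:R * cvar i ^+ (2 * k) + (k.+1 * k)%:R * cvar i ^+ (2 * k).-1 + g.
Proof.
elim: k => [|k [g dg eg]].
  exists 0; first exact: deg_le0.
  by rewrite divstep_cvarXS divstep_cvarX0 mulr0 muln0 expr0 mul0r; ring.
pose t := cvar i ^+ (2 * k).-1.
have et := cvarX_pred i k; rewrite -/t in et.
exists (2 * (k.+1 * k)%:R * cvar i ^+ (2 * k) +
        (k.+1%:R * cvar i ^+ (2 * k) + (k.+1 * k)%:R * t) + (cvar i + 1) ^+ 2 * g).
  have dn (n : nat) : deg_le 0 (n%:R : P) by rewrite -mpolyC_nat deg_leC.
  have du := deg_cvarX i (2 * k); have d2 : 2 * k%:Z = (2 * k)%N by rewrite PoszM.
  have e0 : 2 * k.+1%:Z - 2 = 0 + (2 * k)%N by rewrite -d2; lia.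
  have dt : deg_le (2 * k)%N t by apply: deg_leW (deg_cvarX i _); lia.
  apply: deg_leD; first apply: deg_leD; last 2 first.
  - rewrite e0; apply: deg_leD; [exact: deg_leM (dn _) du|exact: deg_leM (dn _) dt].
  - have -> : 2 * k.+1%:Z - 2 = 1 * 2 + (2 * k%:Z - 2) by lia.
    apply: deg_leM dg; apply: deg_leXn; apply: deg_leD; first exact: deg_cvar.
    exact: deg_leW (deg_le1 _ _).
  by rewrite e0 -natrM; exact: deg_leM (dn _) du.
rewrite divstep_cvarXS eg -/t.
have -> : (2 * k.+1).-1 = (2 * k).+1 by lia.
have e2 : (k.+1 * k)%:R * t * cvar i = (k.+1 * k)%:R * cvar i ^+ (2 * k).
  by rewrite natrM -!mulrA; congr (_ * _); rewrite mulrA et.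
have -> : (cvar i + 1) ^+ 2 * (k.+1%:R * cvar i ^+ (2 * k) + (k.+1 * k)%:R * t + g) =
   (cvar i + 1) ^+ 2 * (k.+1%:R * cvar i ^+ (2 * k)) + (cvar i + 2) * ((k.+1 * k)%:R *
     t * cvar i)
   + (k.+1 * k)%:R * t + (cvar i + 1) ^+ 2 * g by ring.
rewrite e2 mulnS !(exprD, exprS) (natrM _ k.+2) (natrM _ k.+1) -(natr1 k.+1) -(natr1 k).
ring.
Qed.

End Operator.

(** * Leading terms *)

Section RingIdentities.
Variable T : comNzRingType.
Implicit Types (x U V w c al be t : T).

Lemma cvarX_step x k : let U := x ^+ (2 * k) in
  [/\ x ^+ (2 * k.+1) = U * x ^+ 2, x ^+ (2 * k.+1).+1 = U * x ^+ 3,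
     x ^+ (2 * k.+2) = U * x ^+ 4 & x ^+ (2 * k).+1 = U * x].
Proof.
split; rewrite /= -?exprD -?exprSr; congr (_ ^+ _); lia.
Qed.

Lemma lead1_id x V w U c : (x + V) ^+ 2 * (c * U) * (- (x ^+ 2 * w)) =
  - (c * w) * (U * x ^+ 4) + - (c * w * 2 * V) * (U * x ^+ 3) +
  - (c * w * V ^+ 2) * (U * x ^+ 2).
Proof. ring. Qed.

Lemma lead0_id x w U t c d al be : d * t * x = d * U ->
  (x ^+ 2 + al * x) * (c * U + d * t) * (- ((x ^+ 2 + be * x) * w)) =
  - (c * w) * (U * x ^+ 4) + - ((d + c * (al + be)) * w) * (U * x ^+ 3) +
  - ((d * (al + be) + c * al * be) * w) * (U * x ^+ 2) + - (d * al * be * w) * (U * x).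
Proof.
move=> e; have -> : (x ^+ 2 + al * x) * (c * U + d * t) * (- ((x ^+ 2 + be * x) * w))
  = - (w * x * (x + al) * (x + be) * (c * U * x + d * t * x)) by ring.
rewrite e; ring.
Qed.

Lemma lead1_coef c w V : c * w * 2 * V = 2 * c * V * w.
Proof. ring. Qed.

Lemma lead1_sum X lead_slope k2 V w U Gl :
  X + U * Gl + (V ^+ 2 + (lead_slope + k2) * V) * (w * U) =
  (X + k2 * V * w * U) + U * (Gl + (V ^+ 2 + lead_slope * V) * w).
Proof. ring. Qed.

Lemma lead0_sum X e K w U Gl :
  X + U * Gl + (e + K) * (w * U) = (X + K * w * U) + U * (Gl + e * w).
Proof. ring. Qed.

End RingIdentities.

Section Leading.
Variables (R : realType) (p : nat) (b : 'I_p -> R) (bE : R) (N : nat).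
Local Notation P := {mpoly R[p]}.
Implicit Types (i j l : 'I_p) (f g h : P) (c : R).
Implicit Types (s : bool * P * P) (r : seq 'I_p) (m : 'X_{1..p}).
Local Notation G := (chain_op b bE N).
Local Notation site_state := (site_state b).
Local Notation cvar := (cvar b).

Definition reflect_inv i h := refl i (b i) h = h.

Lemma reflect_invM i f g : reflect_inv i f -> reflect_inv i g -> reflect_inv i (f * g).
Proof. by rewrite /reflect_inv => ef eg; rewrite rmorphM /= ef eg. Qed.

Lemma reflect_invD i f g : reflect_inv i f -> reflect_inv i g -> reflect_inv i (f + g).
Proof. by rewrite /reflect_inv => ef eg; rewrite rmorphD /= ef eg. Qed.

Lemma reflect_invN i f : reflect_inv i f -> reflect_inv i (- f).
Proof. by rewrite /reflect_inv => ef; rewrite rmorphN /= ef. Qed.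

Lemma reflect_inv_nat i n : reflect_inv i n%:R.
Proof. by rewrite /reflect_inv rmorph_nat. Qed.

Lemma reflect_invXn i f n : reflect_inv i f -> reflect_inv i (f ^+ n).
Proof. by rewrite /reflect_inv => ef; rewrite rmorphXn /= ef. Qed.

Lemma divdiff_parity i h1 h2 h3 h4 k :
  reflect_inv i h1 -> reflect_inv i h2 -> reflect_inv i h3 -> reflect_inv i h4 ->
  divdiff i (b i) (h1 * cvar i ^+ (2 * k.+2) + h2 * cvar i ^+ (2 * k.+1).+1 +
              h3 * cvar i ^+ (2 * k.+1) + h4 * cvar i ^+ (2 * k).+1) =
  h2 * cvar i ^+ (2 * k.+1) + h4 * cvar i ^+ (2 * k).
Proof.
move=> f1 f2 f3 f4; rewrite 3!(raddfD (divdiff i (b i))) /=.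
transitivity (0 + h2 * cvar i ^+ (2 * k.+1) + 0 + h4 * cvar i ^+ (2 * k)); last first.
  by rewrite add0r addr0.
congr (_ + _); last exact: divdiff_cvarXodd.
congr (_ + _); last exact: divdiff_cvarXeven.
congr (_ + _); last exact: divdiff_cvarXodd.
exact: divdiff_cvarXeven.
Qed.

(** The even monomials in the centred variables are a basis of the invariant
    polynomials, and the chain operator treats their factors one at a time. *)
Definition even_mon r m : P := \prod_(i <- r) cvar i ^+ (2 * m i).
Definition part_deg r m : nat := (\sum_(i <- r) m i)%N.

Lemma even_mon_cons i r m : even_mon (i :: r) m = even_mon r m * cvar i ^+ (2 * m i).
Proof. by rewrite /even_mon big_cons mulrC. Qed.

Lemma part_deg_cons i r m : part_deg (i :: r) m = (m i + part_deg r m)%N.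
Proof. by rewrite /part_deg big_cons. Qed.

Lemma indep_even_mon i r m : i \notin r -> indep i (even_mon r m).
Proof.
move=> ir q; rewrite /even_mon rmorph_prod /= big_seq [RHS]big_seq.
apply: eq_bigr => j jr; rewrite rmorphXn /= indep_cvar //.
by apply: contraNneq ir => <-.
Qed.

Lemma refl_even_mon i r m : refl i (b i) (even_mon r m) = even_mon r m.
Proof.
rewrite /even_mon rmorph_prod /=; apply: eq_bigr => j _.
have [->|ij] := eqVneq i j; first exact: refl_cvarX2.
by rewrite /refl rmorphXn /= indep_cvar // eq_sym.
Qed.

Lemma deg_even_mon r m : deg_le (2 * (part_deg r m)%:Z) (even_mon r m).
Proof.
rewrite /part_deg -natz natr_sum mulr_sumr; apply: deg_le_prod => i.
by have := deg_cvarX b i (2 * m i); rewrite PoszM -[X in 2%Z * X]natz.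
Qed.

Lemma indeps_divstep_cvar i r k : i \notin r -> indeps r (divstep b i (cvar i ^+ (2 *
  k))).
Proof.
move=> ir j jr q; have ij : j != i by apply: contraNneq ir => <-.
elim: k => [|k IH]; first by rewrite divstep_cvarX0 rmorph0.
rewrite divstep_cvarXS rmorphD rmorphM !rmorphXn rmorphD rmorph1 /= IH.
by rewrite indep_cvar // eq_sym.
Qed.

Lemma deg_le_prod3 (a1 a2 a3 d e : int) (x1 x2 x3 y1 y2 y3 : P) :
  a1 + a2 + a3 - e = d -> 0 <= e ->
  deg_le a1 x1 -> deg_le a2 y2 -> deg_le a1 y1 -> deg_le a2 x2 ->
  deg_le a3 y3 -> deg_le a3 x3 ->
  deg_le (a1 - e) (x1 - y1) -> deg_le (a2 - e) (x2 - y2) ->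
  deg_le (a3 - e) (x3 - y3) ->
  deg_le d (x1 * x2 * x3 - y1 * y2 * y3).
Proof.
move=> de e0 h1 h2 h3 h4 h5 h6 d1 d2 d3.
have -> : x1 * x2 * x3 - y1 * y2 * y3 =
  (x1 - y1) * x2 * x3 + y1 * (x2 - y2) * x3 + y1 * y2 * (x3 - y3) by ring.
apply: deg_leD; first apply: deg_leD.
- have -> : d = a1 - e + a2 + a3 by (clear -de; lia).
  exact: deg_leM (deg_leM d1 h4) h6.
- have -> : d = a1 + (a2 - e) + a3 by (clear -de; lia).
  exact: deg_leM (deg_leM h3 d2) h6.
have -> : d = a1 + a2 + (a3 - e) by (clear -de; lia).
exact: deg_leM (deg_leM h3 h2) d3.
Qed.

Lemma indeps_cvarX i r n : i \notin r -> indeps r (cvar i ^+ n).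
Proof.
move=> ir j jr q; have ij : j != i by apply: contraNneq ir => <-.
by rewrite rmorphXn /= indep_cvar // eq_sym.
Qed.

Lemma chain_op_cons_mon s i r m : i \notin r ->
  G s (i :: r) (even_mon (i :: r) m) =
  divdiff i (b i) (link s (site_state i) * divstep b i (cvar i ^+ (2 * m i)) *
    G (site_state i) r (even_mon r m))
  + cvar i ^+ (2 * m i) * G s r (even_mon r m).
Proof.
move=> ir; rewrite even_mon_cons /= (divstep_mull _ _ (indep_even_mon _ ir)).
rewrite [even_mon r m * divstep _ _ _]mulrC (chain_op_mull _ _ _ _ _
  (indeps_divstep_cvar _ ir)).
by rewrite [even_mon r m * _]mulrC (chain_op_mull _ _ _ _ _ (indeps_cvarX _ ir)) mulrA.
Qed.

Lemma mpolyC_half (c : R) : c%:MP = (c / 2)%:MP + (c / 2)%:MP :> P.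
Proof. by rewrite -mpolyCD -splitr. Qed.

Lemma link_pair l i : deg_le 1 (link (site_state l) (site_state i) - (cvar i +
  cvar l) ^+ 2).
Proof.
pose e := b i / 2 - b l / 2.
have -> : link (site_state l) (site_state i) - (cvar i + cvar l) ^+ 2 =
   (2 * e + 1)%:MP * (cvar i + cvar l) + (e * (e + 1))%:MP.
  rewrite /link /cvar /= (mpolyC_half (b i)) /e !(mpolyCD, mpolyCM, mpolyCN, mpolyC1).
  rewrite ?mpolyC_nat; ring.
apply: deg_leD; last exact: deg_leCW.
rewrite -[1]add0r; apply: deg_leM; first exact: deg_leC.
by apply: deg_leD; exact: deg_cvar.
Qed.

Lemma link_first i b0 : deg_le 0 (link (false, 0, b0%:MP) (site_state i) -
   (cvar i ^+ 2 + (b i - b0)%:MP * cvar i)).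
Proof.
have -> : link (false, 0, b0%:MP) (site_state i) - (cvar i ^+ 2 + (b i - b0)%:MP *
  cvar i) =
   (b i / 2 * (b i / 2 - b0))%:MP; last exact: deg_leC.
rewrite /link /cvar /=; have := splitr (b i); move: (b i / 2) => h ->.
rewrite !(mpolyCD, mpolyCM, mpolyCN, mpolyC1, mpolyCB); ring.
Qed.

Lemma link_last i : deg_le 0 (link (site_state i) (end_state p bE N) +
   (cvar i ^+ 2 + (bE - b i)%:MP * cvar i)).
Proof.
have -> : link (site_state i) (end_state p bE N) + (cvar i ^+ 2 + (bE - b i)%:MP *
  cvar i) =
   ((N%:R + b i / 2) * (N%:R - b i / 2 + bE))%:MP; last exact: deg_leC.
rewrite /link /cvar /=; have := splitr (b i); move: (b i / 2) => h ->.
rewrite !(mpolyCD, mpolyCM, mpolyCN, mpolyCB, mpolyC_nat); ring.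
Qed.

Definition lead_slope i r m : P := (bE - b i + 2 * (part_deg r m)%:R)%:MP.

(** Only two orders in u_l matter in what follows.  When a site i is added, the
    term of degree one in u_i of (u_i + u_l)^2 is the only one that survives the
    divided difference at top degree, and it contributes 2 m_i u_l. *)
Lemma chain_op_lead1 l r m : uniq (l :: r) ->
  deg_le (2 * (part_deg r m)%:Z)
    (G (site_state l) r (even_mon r m) + (cvar l ^+ 2 + lead_slope l r m * cvar l) *
      even_mon r m).
Proof.
elim: r l => [|i r IH] l.
  move=> _; rewrite /even_mon /lead_slope /part_deg !big_nil !mulr1 /= !mulr0 addr0 mulr1.
  exact: link_last.
rewrite cons_uniq inE negb_or => /andP[/andP[li lr] /andP[ir ur]].
rewrite chain_op_cons_mon // even_mon_cons part_deg_cons.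
set w := even_mon r m; set D := part_deg r m.
have IHi : deg_le (2 * D%:Z) _ := IH i (introT andP (conj ir ur)).
have IHl : deg_le (2 * D%:Z) _ := IH l (introT andP (conj lr ur)).
rewrite -/w in IHi IHl.
have dw : deg_le (2 * D%:Z) w by exact: deg_even_mon.
have rw := refl_even_mon i r m; rewrite -/w in rw.
have rul : refl i (b i) (cvar l) = cvar l by apply: indep_cvar.
set k := m i.
have main : deg_le (2 * (k + D)%:Z)
  (divdiff i (b i) (link (site_state l) (site_state i) * divstep b i (cvar i ^+ (2 *
    k)) * G (site_state i) r w)
     + (2 * k)%:R * cvar l * w * cvar i ^+ (2 * k)).
  case: k => [|k]; first by rewrite divstep_cvarX0 mulr0 mul0r raddf0 muln0 !mul0r
    addr0 deg_le0.
  (* The product of the leading terms of the three factors. *)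
  pose Y := (cvar i + cvar l) ^+ 2 * (k.+1%:R * cvar i ^+ (2 * k)) * (- (cvar i ^+ 2 *
    w)).
  have ddY : divdiff i (b i) Y = - ((2 * k.+1)%:R * cvar l * w * cvar i ^+ (2 * k.+1)).
    have [e2 e3 e4 _] := cvarX_step (cvar i) k.
    rewrite /Y lead1_id -e2 -e3 -e4.
    have fw : reflect_inv i w by exact: rw.
    have fk := reflect_inv_nat i k.+1; have f2 := reflect_inv_nat i 2;
      have fl : reflect_inv i (cvar l) := rul.
    have fkw := reflect_invM fk fw.
    have := divdiff_parity k (reflect_invN fkw) (reflect_invN (reflect_invM
      (reflect_invM fkw f2) fl))
      (reflect_invN (reflect_invM fkw (reflect_invXn 2 fl))) (reflect_inv_nat i 0).
    rewrite !mul0r !addr0 => ->; rewrite mulNr; congr (- (_ * _)).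
    by rewrite natrM lead1_coef.
  rewrite -[X in _ + X]opprK -ddY -raddfB; apply: deg_le_divdiff.
  have [g dg eg] := divstep_lead b i k.
  have dn (n : nat) : deg_le 0 (n%:R : P) by rewrite -mpolyC_nat deg_leC.
  have du2 : deg_le 2 ((cvar i + cvar l) ^+ 2).
    by have := deg_leXn 2 (deg_leD (deg_cvar b i) (deg_cvar b l)); rewrite mul1r.
  have dE : deg_le (2 - 1) (link (site_state l) (site_state i) - (cvar i +
    cvar l) ^+ 2) by exact: link_pair.
  have dG : deg_le (2 * D%:Z + 1) (G (site_state i) r w - - (cvar i ^+ 2 * w)).
    rewrite opprK (_ : _ + _ = (G (site_state i) r w + (cvar i ^+ 2 +
      lead_slope i r m * cvar i) * w)
      - lead_slope i r m * cvar i * w); last by ring.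
    apply: deg_leB; first by apply: deg_leW IHi; (clear; lia).
    rewrite (_ : 2 * D%:Z + 1 = 0 + 1 + 2 * D%:Z); last by (clear; lia).
    by apply: deg_leM dw; apply: deg_leM; [exact: deg_leC|exact: deg_cvar].
  have duk : deg_le (2 * k%:Z) (cvar i ^+ (2 * k)) by have := deg_cvarX b i (2 * k);
    rewrite PoszM.
  have dy2 : deg_le (2 * k%:Z) (k.+1%:R * cvar i ^+ (2 * k)).
    by rewrite -[2 * _]add0r; exact: deg_leM (dn _) duk.
  have dx2 : deg_le (2 * k%:Z - 1) (divstep b i (cvar i ^+ (2 * k.+1)) - k.+1%:R *
    cvar i ^+ (2 * k)).
    rewrite eg (_ : _ - _ = (k.+1 * k)%:R * cvar i ^+ (2 * k).-1 + g); last by ring.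
    apply: deg_leD; last by apply: deg_leW dg; (clear; lia).
    case: (k) => [|k']; first by rewrite muln0 mul0r deg_le0.
    rewrite -[2 * _ - 1]add0r; apply: deg_leM (dn _) _.
    by apply: deg_leW (deg_cvarX b i _); (clear; lia).
  have dy3 : deg_le (2 * D%:Z + 2) (- (cvar i ^+ 2 * w)).
    rewrite deg_leN addrC; apply: deg_leM dw.
    by have := deg_cvarX b i 2.
  have back (d : int) (x y : P) : deg_le d y -> deg_le (d - 1) (x - y) -> deg_le d x.
    move=> dy dxy; rewrite -(subrK y x); apply: deg_leD dy.
    by apply: deg_leW dxy; (clear; lia).
  have dx3 : deg_le (2 * D%:Z + 2 - 1) (G (site_state i) r w - - (cvar i ^+ 2 * w)).
    by apply: deg_leW dG; (clear; lia).
  have de : 2 + 2 * k%:Z + (2 * D%:Z + 2) - 1 = 2 * (k.+1 + D)%:Z + 1 by (clear; lia).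
  have e0 : 0 <= 1 :> int by [].
  exact: (deg_le_prod3 de e0 (back _ _ _ du2 dE) dy2 du2 (back _ _ _ dy2 dx2)
     dy3 (back _ _ _ dy3 dx3) dE dx2 dx3).
rewrite (_ : lead_slope l (i :: r) m = lead_slope l r m + (2 * k)%:R); last first.
  rewrite /lead_slope part_deg_cons -/D -/k -mpolyC_nat -mpolyCD; congr (mpolyC _ _).
  by rewrite natrD natrM; ring.
rewrite lead1_sum.
apply: deg_leD main _; rewrite PoszD mulrDr; apply: deg_leM IHl.
by have := deg_cvarX b i (2 * k); rewrite PoszM.
Qed.

Variable b0 : R.

(** Minus the eigenvalue in degree d. *)
Definition eigen (d : nat) : R := d%:R * (d%:R - 1 + bE - b0).

(** The first moved site i contributes m_i (m_i - 1) + m_i (bE - b0 + 2 D), where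
    D is the degree carried by the later sites; this is
    [eigen (m_i + D) - eigen D]. *)
Lemma chain_op_lead0 r m : uniq r ->
  deg_le (2 * (part_deg r m)%:Z - 1)
    (G (false, 0, b0%:MP) r (even_mon r m) + (eigen (part_deg r m))%:MP * even_mon r m).
Proof.
elim: r => [|i r IH].
  by move=> _; rewrite /eigen /part_deg !big_nil mul0r mpolyC0 mul0r addr0 deg_le0.
rewrite cons_uniq => /andP[ir ur].
rewrite chain_op_cons_mon // even_mon_cons part_deg_cons.
set s0 := (false, 0, b0%:MP).
set w := even_mon r m; set D := part_deg r m.
have IH0 : deg_le (2 * D%:Z - 1) _ := IH ur.
have IHi : deg_le (2 * D%:Z) _ := chain_op_lead1 m (introT andP (conj ir ur)).
rewrite -/w -/s0 in IHi IH0.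
have dw : deg_le (2 * D%:Z) w by exact: deg_even_mon.
have rw := refl_even_mon i r m; rewrite -/w in rw.
set k := m i.
pose al : P := (b i - b0)%:MP; pose be := lead_slope i r m.
have rc c : refl i (b i) c%:MP = c%:MP by exact: reflC.
have dn (n : nat) : deg_le 0 (n%:R : P) by rewrite -mpolyC_nat deg_leC.
have duk n : deg_le (2 * n%:Z) (cvar i ^+ (2 * n)).
  by have := deg_cvarX b i (2 * n); rewrite PoszM.
pose K : P := (k * k.-1)%:R + k%:R * (al + be).
have main : deg_le (2 * (k + D)%:Z - 1)
  (divdiff i (b i) (link s0 (site_state i) * divstep b i (cvar i ^+ (2 * k)) *
    G (site_state i) r w)
     + K * w * cvar i ^+ (2 * k)).
  rewrite {}/K; case: k => [|k].
    by rewrite divstep_cvarX0 mulr0 mul0r raddf0 mul0n !mul0r addr0 !mul0r addr0 deg_le0.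
  pose t := cvar i ^+ (2 * k).-1.
  pose Y2 := k.+1%:R * cvar i ^+ (2 * k) + (k.+1 * k)%:R * t.
  (* Here the two leading terms of each factor matter. *)
  pose Y := (cvar i ^+ 2 + al * cvar i) * Y2 * (- ((cvar i ^+ 2 + be * cvar i) * w)).
  have ddY : divdiff i (b i) Y = - (((k.+1 * k)%:R + k.+1%:R * (al + be)) * w *
    cvar i ^+ (2 * k.+1))
      - (k.+1 * k)%:R * al * be * w * cvar i ^+ (2 * k).
    have [e2 e3 e4 e1] := cvarX_step (cvar i) k.
    rewrite /Y /Y2 lead0_id; last by rewrite natrM -!mulrA; congr (_ * _);
      rewrite mulrA cvarX_pred.
    rewrite -e2 -e3 -e4 -e1.
    have fw : reflect_inv i w by exact: rw.
    have fk := reflect_inv_nat i k.+1; have fd := reflect_inv_nat i (k.+1 * k).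
    have fa : reflect_inv i al := rc _; have fb : reflect_inv i be := rc _.
    have fab := reflect_invD fa fb.
    rewrite (divdiff_parity k (reflect_invN (reflect_invM fk fw)) (reflect_invN
      (reflect_invM (reflect_invD fd (reflect_invM fk fab)) fw))
      (reflect_invN (reflect_invM (reflect_invD (reflect_invM fd fab) (reflect_invM
        (reflect_invM fk fa) fb)) fw))
      (reflect_invN (reflect_invM (reflect_invM (reflect_invM fd fa) fb) fw))).
    by rewrite !mulNr.
  have -> : divdiff i (b i) (link s0 (site_state i) * divstep b i (cvar i ^+ (2 *
    k.+1)) * G (site_state i) r w)
     + ((k.+1 * k.+1.-1)%:R + k.+1%:R * (al + be)) * w * cvar i ^+ (2 * k.+1) =
     divdiff i (b i) (link s0 (site_state i) * divstep b i (cvar i ^+ (2 * k.+1)) *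
       G (site_state i) r w - Y)
     - (k.+1 * k)%:R * al * be * w * cvar i ^+ (2 * k).
    rewrite raddfB /= ddY; ring.
  apply: deg_leB; last first.
    have -> : 2 * (k.+1 + D)%:Z - 1 = 1 + (2 * D%:Z + 2 * k%:Z) by (clear; lia).
    apply: (@deg_leW _ _ (0 + 0 + 0 + 2 * D%:Z + 2 * k%:Z)); first by (clear; lia).
    apply: deg_leM (duk _); apply: deg_leM dw.
    by apply: deg_leM; [apply: deg_leM (dn _) _|]; exact: deg_leC.
  apply: deg_le_divdiff.
  have [g dg eg] := divstep_lead b i k.
  have dal : deg_le 2 (cvar i ^+ 2 + al * cvar i).
    apply: deg_leD; first exact: deg_cvarX.
    by apply: (@deg_leW _ _ (0 + 1)) => //; apply: deg_leM (deg_leC _ _) (deg_cvar _ _).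
  have dbe : deg_le 2 (cvar i ^+ 2 + be * cvar i).
    apply: deg_leD; first exact: deg_cvarX.
    by apply: (@deg_leW _ _ (0 + 1)) => //; apply: deg_leM (deg_leC _ _) (deg_cvar _ _).
  have dy2 : deg_le (2 * k%:Z) Y2.
    rewrite -[2 * _]add0r; apply: deg_leD; first exact: deg_leM (dn _) (duk _).
    apply: deg_leM (dn _) _.
    by apply: deg_leW (deg_cvarX b i _); (clear; lia).
  have dy3 : deg_le (2 * D%:Z + 2) (- ((cvar i ^+ 2 + be * cvar i) * w)).
    by rewrite deg_leN addrC; apply: deg_leM dw.
  have back (d : int) (x y : P) : deg_le d y -> deg_le (d - 2) (x - y) -> deg_le d x.
    move=> dy dxy; rewrite -(subrK y x); apply: deg_leD dy.
    by apply: deg_leW dxy; (clear; lia).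
  have dx1 : deg_le (2 - 2) (link s0 (site_state i) - (cvar i ^+ 2 + al *
    cvar i)) by exact: link_first.
  have dx2 : deg_le (2 * k%:Z - 2) (divstep b i (cvar i ^+ (2 * k.+1)) - Y2).
    by rewrite eg (_ : _ - _ = g) // /Y2 /t; ring.
  have dx3 : deg_le (2 * D%:Z + 2 - 2) (G (site_state i) r w - (- ((cvar i ^+ 2 + be *
    cvar i) * w))).
    by rewrite opprK addrK.
  have de : 2 + 2 * k%:Z + (2 * D%:Z + 2) - 2 = 2 * (k.+1 + D)%:Z - 1 + 1 by (clear; lia).
  have e0 : 0 <= 2 :> int by [].
  exact: (deg_le_prod3 de e0 (back _ _ _ dal dx1) dy2 dal (back _ _ _ dy2 dx2)
     dy3 (back _ _ _ dy3 dx3) dx1 dx2 dx3).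
rewrite (_ : (eigen (k + D))%:MP = (eigen D)%:MP + K); last first.
  clear main; rewrite /eigen {}/K /al /be /lead_slope -/D.
  case: k => [|k]; first by rewrite add0n mul0n !mul0r !addr0.
  rewrite -!mpolyC_nat -!mpolyCD -!mpolyCM -!mpolyCD; congr (mpolyC _ _).
  by rewrite addSn -(natr1 (k + D)) natrD natrM /= -(natr1 k); ring.
rewrite lead0_sum.
apply: deg_leD main _; rewrite PoszD mulrDr -addrA; apply: deg_leM IH0.
exact: duk.
Qed.

End Leading.

(** * Reflection-invariant polynomials and triangularity *)

Section PLambda.
Variables (R : realType) (p : nat) (beta : 'I_p.+2 -> R) (N : nat).
Local Notation P := {mpoly R[p]}.
Implicit Types (i j : 'I_p) (f g h : P) (c : R) (m : 'X_{1..p}).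

Definition site_beta i : R := beta (inord i.+1).
Local Notation cvar := (cvar site_beta).
Local Notation even_mon := (even_mon site_beta (enum 'I_p)).
Local Notation reflect_inv := (reflect_inv site_beta).
Local Notation inP := (in_Plambda_le beta).

Lemma tnth_lambda i : tnth (lambda beta) i = 'X_i * ('X_i + (site_beta i)%:MP).
Proof. by rewrite tnth_mktuple. Qed.

Lemma tnth_lambda_cvar i : tnth (lambda beta) i =
  cvar i ^+ 2 - ((site_beta i / 2) ^+ 2)%:MP.
Proof.
rewrite tnth_lambda /cvar; have := splitr (site_beta i); move: (site_beta i / 2) => h ->.
rewrite mpolyCD rmorphXn /=; ring.
Qed.

Lemma reflect_inv_lambda i j : reflect_inv i (tnth (lambda beta) j).
Proof.
rewrite tnth_lambda_cvar /reflect_inv rmorphB rmorphXn /= reflC.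
have [->|ij] := eqVneq i j; first by rewrite refl_cvar sqrrN.
by rewrite (refl_indep _ (indep_cvar _ _)) // eq_sym.
Qed.

Lemma inP_reflect_inv d f i : inP d f -> reflect_inv i f.
Proof.
move=> [h [_ ->]]; rewrite /reflect_inv.
apply: (@mpoly_morph_ext _ _ _ (refl i (site_beta i) \o comp_mpoly (lambda beta))
   (comp_mpoly (lambda beta))) => [c|j] /=; first by rewrite comp_mpolyC reflC.
by rewrite comp_mpolyXU -tnth_nth; exact: reflect_inv_lambda.
Qed.

Lemma inP_deg d f : inP d f -> deg_le (2 * d) f.
Proof.
move=> [h [hd ->]]; apply: (@deg_le_comp _ _ d 2) => [i|].
  rewrite tnth_lambda (_ : 2%N%:Z = 1 + 1) //.
  apply: deg_leM; first exact: deg_leX.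
  by apply: deg_leD; [exact: deg_leX|exact: deg_leCW].
by rewrite /deg_le hd orbT.
Qed.

Lemma deg_le_msize d f : deg_le d f -> -1 <= d -> (msize f)%:Z <= d + 1.
Proof.
rewrite /deg_le => /orP[/eqP ->|//]; rewrite msize0 => d1.
by rewrite -lerBlDr sub0r.
Qed.

Lemma inPD d f g : inP d f -> inP d g -> inP d (f + g).
Proof.
move=> [h [hd ->]] [k [kd ->]]; exists (h + k); split; last by rewrite comp_mpolyD.
have := msizeD_le h k; move: hd kd.
by move: (msize h) (msize k) (msize _) => x y z; clear; lia.
Qed.

Lemma inPZ d c f : inP d f -> inP d (c *: f).
Proof.
move=> [h [hd ->]]; exists (c *: h); split; last by rewrite comp_mpolyZ.
by apply: le_trans hd; rewrite lez_nat msizeZ_le.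
Qed.

Lemma inP0 d : -1 <= d -> inP d 0.
Proof.
move=> d1; exists 0; split; last by rewrite comp_mpoly0.
exact: deg_le_msize (deg_le0 _ _ d) d1.
Qed.

Lemma inPW d e f : d <= e -> inP d f -> inP e f.
Proof.
move=> de [h [hd ->]]; exists h; split=> //; apply: le_trans hd _.
by rewrite lerD2r.
Qed.

Lemma part_deg_enum m : part_deg (enum 'I_p) m = mdeg m.
Proof. by rewrite /part_deg mdegE big_enum. Qed.

Lemma even_monE m : even_mon m = \prod_i cvar i ^+ (2 * m i).
Proof. by rewrite /even_mon big_enum. Qed.

Lemma inP_even_mon m : inP (mdeg m)%:Z (even_mon m).
Proof.
exists (\prod_i ('X_i + ((site_beta i / 2) ^+ 2)%:MP) ^+ m i); split.
  apply: deg_le_msize => //.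
  have -> : (mdeg m)%:Z = \sum_i (m i)%:Z.
    by rewrite mdegE -natz natr_sum; apply: eq_bigr => i _; rewrite natz.
  apply: deg_le_prod => i; rewrite -[(m i)%:Z]mul1r; apply: deg_leXn.
  by apply: deg_leD; [exact: deg_leX|exact: deg_leCW].
rewrite even_monE rmorph_prod /=; apply: eq_bigr => i _.
rewrite rmorphXn rmorphD /= comp_mpolyC comp_mpolyXU -tnth_nth tnth_lambda_cvar.
by rewrite subrK exprM.
Qed.

Definition recenter (c : R) : p.-tuple P := [tuple 'X_i + (c *
  (site_beta i / 2))%:MP | i < p].

Lemma recenterK f : (f \mPo recenter (-1)) \mPo recenter 1 = f.
Proof.
apply: (@mpoly_morph_ext _ _ _ (comp_mpoly (recenter 1) \o comp_mpoly (recenter (-1)))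
   idfun) => [c|j] /=; first by rewrite !comp_mpolyC.
rewrite comp_mpolyXU -tnth_nth tnth_mktuple comp_mpolyD comp_mpolyC comp_mpolyXU.
by rewrite -tnth_nth tnth_mktuple mul1r mulN1r mpolyCN addrK.
Qed.

Lemma subst_oppX i m :
  subst_var i (- 'X_i) 'X_[m] = (-1) ^+ m i *: 'X_[R, m] :> P.
Proof.
rewrite (mpolyXE_id _ m) rmorph_prod /= (bigD1 i) //= [in RHS](bigD1 i) //=.
rewrite rmorphXn /= subst_varXX (exprNn 'X_i) -mul_mpolyC [in RHS]mulrA; congr (_ * _ *
  _).
  by rewrite rmorphXn rmorphN rmorph1.
by apply: eq_bigr => j ji; rewrite rmorphXn /= subst_varX (negbTE ji).
Qed.

Lemma odd_coeff f i m : subst_var i (- 'X_i) f = f -> odd (m i) -> f@_m = 0.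
Proof.
move=> ef om; have : f@_m = - f@_m.
  have E : subst_var i (- 'X_i) f =
      \sum_(m' <- msupp f) subst_var i (- 'X_i) (f@_m' *: 'X_[m']).
    by rewrite {1}(mpolyE f) raddf_sum.
  rewrite -{1}ef E raddf_sum.
  have H m' : (subst_var i (- 'X_i) (f@_m' *: 'X_[m']))@_m =
     (-1) ^+ m' i * (f@_m' * (m' == m)%:R).
    rewrite /subst_var comp_mpolyZ mcoeffZ -/(subst_var i _ _) subst_oppX.
    by rewrite mcoeffZ mcoeffX; ring.
  rewrite (eq_bigr _ (fun m' _ => H m')).
  have [mf|mf] := boolP (m \in msupp f); last first.
    rewrite (memN_msupp_eq0 mf) oppr0 big_seq big1 // => m' m'f.
    have -> : (m' == m) = false by apply: contraNF mf => /eqP <-.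
    by rewrite !mulr0.
  rewrite (bigD1_seq m) //= eqxx mulr1 -signr_odd om expr1 mulN1r big1 ?addr0 //.
  by move=> m' /negbTE ->; rewrite !mulr0.
move=> /eqP; rewrite -addr_eq0 -mulr2n mulrn_eq0 /= => /eqP //.
Qed.

(** In the centred variables the reflections are sign changes, so only even
    exponents occur. *)
Lemma even_decomp f (D : int) : (forall i, reflect_inv i f) -> deg_le D f ->
  exists (s : seq 'X_{1..p}) (c : 'X_{1..p} -> R),
    (forall m, m \in s -> 2 * (mdeg m)%:Z <= D) /\ f = \sum_(m <- s) c m *: even_mon m.
Proof.
move=> ff df; pose g := f \mPo recenter (-1).
have dg : deg_le D g.
  rewrite -[D]mul1r; apply: (@deg_le_comp _ _ D 1%N) => // i; rewrite tnth_mktuple.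
  by apply: deg_leD; [exact: deg_leX|exact: deg_leCW].
have gi i : subst_var i (- 'X_i) g = g.
  have ffi : refl i (site_beta i) f = f by exact: ff.
  rewrite /g -[X in _ = X \mPo _]ffi.
  apply: (@mpoly_morph_ext _ _ _ (subst_var i (- 'X_i) \o comp_mpoly (recenter (-1)))
    (comp_mpoly (recenter (-1)) \o refl i (site_beta i))) => [c|j] /=.
    by rewrite comp_mpolyC subst_varC reflC comp_mpolyC.
  rewrite comp_mpolyXU -tnth_nth tnth_mktuple rmorphD /= subst_varC /refl !subst_varX.
  case: eqP => [->|_]; last by rewrite comp_mpolyXU -tnth_nth tnth_mktuple.
  rewrite comp_mpolyB comp_mpolyN comp_mpolyC comp_mpolyXU -tnth_nth tnth_mktuple.
  have := splitr (site_beta i); move: (site_beta i / 2) => h ->.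
  rewrite !(mpolyCD, mpolyCM, mpolyCN, mpolyC1); ring.
pose hf m : 'X_{1..p} := [multinom (m i)./2 | i < p]%MM.
pose db m : 'X_{1..p} := [multinom (2 * m i)%N | i < p]%MM.
have dbK m : m \in msupp g -> db (hf m) = m.
  move=> mg; apply/mnmP => i; rewrite !mnmE; rewrite mul2n -{2}(odd_double_half (m i)).
  suff -> : odd (m i) = false by [].
  by apply: contraTF mg => om; rewrite -mcoeff_eq0 (odd_coeff (gi i) om).
exists [seq hf m | m <- msupp g], (fun m => g@_(db m)); split.
  move=> _ /mapP[m mg ->]; have := msize_mdeg_lt mg.
  rewrite -{1}(dbK m mg); have : g != 0 by apply: contraTneq mg => ->; rewrite msupp0.
  have -> : mdeg (db (hf m)) = (2 * mdeg (hf m))%N.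
    by rewrite !mdegE big_distrr /=; apply: eq_bigr => i _; rewrite !mnmE.
  move: dg; rewrite /deg_le => /orP[->//|].
  by move: (msize g) (mdeg (hf m)) => x y; clear; lia.
rewrite big_map -[LHS](recenterK f) -/g comp_mpolyE.
rewrite big_seq [RHS]big_seq; apply: eq_bigr => m mg; rewrite dbK //; congr (_ *: _).
rewrite even_monE; apply: eq_bigr => i _; rewrite tnth_mktuple mul1r.
by rewrite -{1}(dbK m mg) !mnmE.
Qed.

Lemma even_inP (d : nat) f : (forall i, reflect_inv i f) -> deg_le (2 * d%:Z - 1) f ->
  inP (d%:Z - 1) f.
Proof.
move=> ff df; have [s [c [hs ->]]] := even_decomp ff df.
rewrite big_seq; elim/big_ind: _ => [||m ms]; [|exact: inPD|].
  by apply: inP0; clear; lia.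
apply: inPZ; apply: inPW (inP_even_mon m).
by have := hs m ms; move: (mdeg m) => x; clear; lia.
Qed.

Variables (bE b0 : R).
Local Notation s0 := (false, 0, b0%:MP).

Definition Lpoly f : P := chain_op site_beta bE N s0 (enum 'I_p) f.

Lemma LpolyZ c f : Lpoly (c *: f) = c *: Lpoly f.
Proof.
rewrite -!mul_mpolyC; apply: chain_op_mull => j _; exact: indepC.
Qed.

Lemma Lpoly_reflect_inv f : (forall i, reflect_inv i f) ->
  forall i, reflect_inv i (Lpoly f).
Proof.
by move=> ff i; apply: chain_op_refl; rewrite /= ?rmorph0 ?reflC //; exact: ff.
Qed.

(** Triangularity, from the leading terms on even monomials.  The remainder is
    invariant of degree below 2 d, and the bound d - 1 for its degree in the
    lambda_i follows since invariant polynomials have even degree. *)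
Lemma Lpoly_lead (d : nat) f : inP d%:Z f ->
  inP (d%:Z - 1) (Lpoly f + eigen bE b0 d *: f).
Proof.
move=> fP; have ff i : reflect_inv i f by exact: inP_reflect_inv fP.
apply: even_inP => [i|].
  apply: reflect_invD; first exact: Lpoly_reflect_inv.
  by rewrite -mul_mpolyC; apply: reflect_invM => //; exact: reflC.
have [s [c [hs ->]]] := even_decomp ff (inP_deg fP).
rewrite {1}/Lpoly raddf_sum /= scaler_sumr -big_split /= big_seq.
apply: deg_le_sum => m /hs hm.
have := @chain_op_lead0 R p site_beta bE N b0 (enum 'I_p) m (enum_uniq 'I_p).
rewrite part_deg_enum -/(Lpoly _) mul_mpolyC => lead.
have -> : chain_op site_beta bE N s0 (enum 'I_p) (c m *: even_mon m) =
  c m *: Lpoly (even_mon m) by exact: LpolyZ.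
rewrite scalerA [_ * c m]mulrC -scalerA -scalerDr; apply: deg_leZ.
have -> : Lpoly (even_mon m) + eigen bE b0 d *: even_mon m =
  (Lpoly (even_mon m) + eigen bE b0 (mdeg m) *: even_mon m) +
  (eigen bE b0 d - eigen bE b0 (mdeg m)) *: even_mon m.
  by rewrite scalerBl -addrA [_ + (_ - _)]addrC subrK.
apply: deg_leD; first by apply: deg_leW lead; move: hm; clear; lia.
have [->|md] := eqVneq (mdeg m) d; first by rewrite subrr scale0r deg_le0.
apply: deg_leZ; apply: deg_leW (deg_even_mon site_beta (enum 'I_p) m).
by rewrite part_deg_enum; move: hm md; clear; lia.
Qed.

End PLambda.

(** * Values of the chain operator at lattice points *)

Section GridValue.
Variables (R : realType) (p : nat) (b : 'I_p -> R) (bE : R) (N : nat).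
Hypothesis bnat : forall i n, b i != - n%:R.
Local Notation P := {mpoly R[p]}.
Implicit Types (i j m l : 'I_p) (f g h : P) (v x : 'I_p -> nat) (z : 'I_p -> R).
Implicit Types (s : bool * P * P) (r : seq 'I_p).
Local Notation G := (chain_op b bE N).
Local Notation site_state := (site_state b).
Local Notation end_state := (end_state p bE N).
Local Notation reflect_inv := (reflect_inv b).
Let tend : bool * R * R := (false, N%:R, bE).
Local Notation diff_chain := (diff_chain b tend).

Lemma eq_diff_chain x (s : bool * R * R) r (G1 G2 : ('I_p -> nat) -> R) v :
  (forall w, (forall j, j \notin r -> w j = v j) -> G1 w = G2 w) ->
  diff_chain x s r G1 v = diff_chain x s r G2 v.
Proof.
elim: r s v => [|m r IH] s v H /=; first by rewrite H.
have Hv w : (forall j, j \notin r -> w j = v j) -> G1 w = G2 w.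
  move=> wv; apply: H => j; rewrite inE negb_or => /andP[_ jr]; exact: wv.
rewrite (IH s v Hv); congr (_ + _); apply: eq_bigr => y _.
rewrite (IH _ v Hv) (IH _ (upd v m y)) // => w wv; apply: H => j.
by rewrite inE negb_or => /andP[jm jr]; rewrite wv // upd_other.
Qed.

Lemma diff_chain_lin x (s : bool * R * R) r (G1 G2 : ('I_p -> nat) -> R) v (c : R) :
  diff_chain x s r (fun w => (G1 w - G2 w) / c) v =
  (diff_chain x s r G1 v - diff_chain x s r G2 v) / c.
Proof.
elim: r s v => [|m r IH] s v /=; first by rewrite mulrA mulrBr.
rewrite IH.
have -> : \sum_(y <- neighbours (x m)) hop s (moved (x m) y (b m)) *
   (diff_chain x (moved (x m) y (b m)) r (fun w => (G1 w - G2 w) / c) (upd v m y) -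
    diff_chain x (moved (x m) y (b m)) r (fun w => (G1 w - G2 w) / c) v) =
   (\sum_(y <- neighbours (x m)) hop s (moved (x m) y (b m)) *
     (diff_chain x (moved (x m) y (b m)) r G1 (upd v m y) -
      diff_chain x (moved (x m) y (b m)) r G1 v) -
    \sum_(y <- neighbours (x m)) hop s (moved (x m) y (b m)) *
     (diff_chain x (moved (x m) y (b m)) r G2 (upd v m y) -
      diff_chain x (moved (x m) y (b m)) r G2 v)) / c.
  rewrite -sumrB mulr_suml; apply: eq_bigr => y _; rewrite !IH; ring.
ring.
Qed.

Lemma diff_chain_upd x (s : bool * R * R) r (H : ('I_p -> nat) -> R) v m y : m \notin r ->
  diff_chain x s r H (upd v m y) = diff_chain x s r (fun w => H (upd w m y)) v.
Proof.
elim: r s v => [|m' r IH] s v //=; rewrite inE negb_or => /andP[mm mr].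
rewrite IH //; congr (_ + _); apply: eq_bigr => y' _.
rewrite -!IH //; congr (_ * (diff_chain _ _ _ _ _ - _)).
apply/funext => j; rewrite /upd; case: (eqVneq j m') => // ->.
by rewrite eq_sym (negbTE mm).
Qed.

(** The lattice coordinates [v] on the sites still to be treated, and the possibly
    reflected real coordinates [z] on the others. *)
Definition mix r v z : 'I_p -> R := fun j => if j \in r then (v j)%:R else z j.

Definition state_at s z : bool * R * R := (s.1.1, s.1.2.@[z], s.2.@[z]).
Definition sindep s r := forall i, i \in r -> indep i s.1.2 /\ indep i s.2.

Lemma indep_meval i f z (c : R) : indep i f ->
  f.@[fun j => if j == i then c else z j] = f.@[z].
Proof. by move=> /(_ c%:MP) {2}<-; rewrite subst_var_meval mevalC. Qed.

Lemma reflect_inv_meval i f z : reflect_inv i f ->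
  f.@[fun j => if j == i then - z i - b i else z j] = f.@[z].
Proof.
by rewrite /reflect_inv => {2}<-; rewrite subst_var_meval mevalB mevalN mevalXU mevalC.
Qed.

Lemma link_meval s m z : (link s (site_state m)).@[z] =
  link (state_at s z) (true, z m, b m).
Proof. by rewrite link_morph ?orbT //= mevalXU mevalC. Qed.

Definition updz z m (t : R) : 'I_p -> R := fun j => if j == m then t else z j.

Lemma divstep_meval m f z : 2 * z m + (b m + 1) != 0 -> reflect_inv m f ->
  (divstep b m f).@[z] = (f.@[updz z m (z m + 1)] - f.@[z]) / (2 * z m + b m + 1).
Proof.
move=> n0 ff; apply: (mulIf n0); rewrite -[2 * z m + b m + 1]addrA divfK //.
rewrite -axis_meval mulrC -mevalM divstep_axis // mevalB subst_var_meval.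
by rewrite mevalD mevalXU meval1.
Qed.

Lemma bnat_add m (n : nat) : b m + n%:R != 0.
Proof. by rewrite addr_eq0 bnat. Qed.

Lemma link_at0 (s : bool * R * R) m : s.1.2 = 0 -> link s (true, - 0%N%:R - b m, b m) = 0.
Proof.
case: s => [[a yl] bl] /= ->; rewrite /link oppr0 sub0r addr0 addNr.
by case: a; rewrite !mul0r.
Qed.

(** Evaluation of the chain operator, site by site.  The divided difference at
    site m is the sum over the two directions; the reflected point gives the
    backward move because f is invariant.  At x_m = 0 the division by
    2 x_m + b_m - 1 may be impossible, but there the link to the reflected site
    is 0, so that term is never expanded.  The correction on the left is the
    term of the empty subset. *)
Lemma chain_op_meval s r f x z : uniq r ->
  (forall j, j \in r -> z j = (x j)%:R) ->
  (forall j, j \in r -> reflect_inv j f) -> sindep s r -> admissible x (state_at s z) r ->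
  (G s r f).@[z] + (if s.1.1 then 0 else link (state_at s z) tend * f.@[z]) =
  diff_chain x (state_at s z) r (fun v => f.@[mix r v z]) x.
Proof.
elim: r s f z => [|m r IH] s f z /=.
  move=> _ _ _ _ _; have -> : f.@[mix [::] x z] = f.@[z] by apply: meval_eq.
  case: ifP => sa; last by rewrite meval0 add0r.
  rewrite addr0 mevalM; congr (_ * _); rewrite link_morph ?sa //=.
  by rewrite rmorph_nat mevalC /state_at; case: s sa => [[a yl] bl] /= ->.
move=> /andP[mr ur] zx ff si gs.
have zr j : j \in r -> z j = (x j)%:R by move=> jr; apply: zx; rewrite inE jr orbT.
have fr j : j \in r -> reflect_inv j f by move=> jr; apply: ff; rewrite inE jr orbT.
have sir : sindep s r by move=> j jr; apply: si; rewrite inE jr orbT.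
have im j : j \in r -> j != m by move=> jr; apply: contraNneq mr => <-.
have zm : z m = (x m)%:R by apply: zx; rewrite mem_head.
have fm : reflect_inv m f by apply: ff; rewrite mem_head.
have [g0 gr _ gy] := admissible_cons b gs.
pose F v := f.@[mix (m :: r) v z].
have mix_r v : v m = x m -> f.@[mix r v z] = F v.
  move=> vm; apply: meval_eq => j; rewrite /mix inE.
  by case: eqVneq => [->|] //=; rewrite (negbTE mr) zm vm.
rewrite mevalD -addrA IH //.
have -> : diff_chain x (state_at s z) r (fun v => f.@[mix r v z]) x =
  diff_chain x (state_at s z) r F x.
  by apply: eq_diff_chain => w wx; apply: mix_r; apply: wx.
congr (_ + _).
have sz t : state_at s (updz z m t) = state_at s z.
  rewrite /state_at; have [i1 i2] := si m (mem_head _ _).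
  by rewrite /updz !indep_meval.
pose h := link s (site_state m) * G (site_state m) r (divstep b m f).
have hval (y : nat) (t : R) : y \in neighbours (x m) -> t = (moved (x m) y (b m)).1.2 ->
    2 * t + b m != 0 -> 2 * t + b m + 1 != 0 ->
    (forall v, (forall j, j \notin r -> v j = x j) ->
       f.@[mix r v (updz z m (t + 1))] = F (upd v m y)) ->
    (forall v, (forall j, j \notin r -> v j = x j) -> f.@[mix r v (updz z m t)] = F v) ->
    h.@[updz z m t] / (2 * t + b m) =
    hop (state_at s z) (moved (x m) y (b m)) *
      (diff_chain x (moved (x m) y (b m)) r F (upd x m y) - diff_chain x (moved (x m) y
        (b m)) r F x).
  move=> yn et n0 n1 H1 H0.
  have emv : moved (x m) y (b m) = (true, t, b m).
    have yx : y != x m by move: yn; clear; case: (x m) => [|k]; rewrite !inE; lia.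
    by rewrite et /moved yx.
  have upm : updz z m t m = t by rewrite /updz eqxx.
  have zur j : j \in r -> updz z m t j = (x j)%:R.
    by move=> jr; rewrite /updz (negbTE (im j jr)) zr.
  have es : state_at (site_state m) (updz z m t) = (true, t, b m).
    by rewrite /state_at /= mevalXU mevalC upm.
  have fd j : j \in r -> reflect_inv j (divstep b m f).
    by move=> jr; rewrite /reflect_inv (refl_divstep _ _ _ (im j jr)) fr.
  have sm : sindep (site_state m) r.
    move=> j jr; split; last exact: indepC.
    by apply: indepX; rewrite eq_sym im.
  have gm : admissible x (state_at (site_state m) (updz z m t)) r by rewrite es -emv;
    apply: gy.
  have := IH (site_state m) (divstep b m f) (updz z m t) ur zur fd sm gm.
  rewrite /= addr0 es => eG.
  rewrite /h mevalM link_meval upm eG -emv.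
  rewrite sz (diff_chain_upd _ _ _ _ _ mr).
  rewrite (_ : diff_chain x (moved (x m) y (b m)) r (fun v => (divstep b m f).@[mix r v
    (updz z m t)]) x =
    diff_chain x (moved (x m) y (b m)) r (fun v => (F (upd v m y) - F v) / (2 * t +
      b m + 1)) x).
    rewrite diff_chain_lin /hop emv /site_den /=; field; by rewrite n0 n1.
  apply: eq_diff_chain => v vx.
  have mt : mix r v (updz z m t) m = t by rewrite /mix (negbTE mr).
  rewrite divstep_meval // mt ?addrA //; congr ((_ - _) / _); last exact: H0.
  rewrite -H1 //; apply: meval_eq => j; rewrite /mix /updz.
  by case: (eqVneq j m) => [->|]; rewrite ?(negbTE mr).
(* The forward move exists at every point, the backward one only for x m > 0. *)
have n0 : 2 * z m + b m != 0 by rewrite zm addrC -natrM bnat_add.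
have Fm v t : f.@[mix r v (updz z m t)] =
    f.@[fun j => if j == m then t else mix (m :: r) v z j].
  apply: meval_eq => j; rewrite /mix /updz inE.
  by case: (eqVneq j m) => [->|]; rewrite ?(negbTE mr).
have Fu v y : f.@[mix r v (updz z m y%:R)] = F (upd v m y).
  rewrite Fm; apply: meval_eq => j; rewrite /mix /upd inE.
  by case: (eqVneq j m) => [->|].
have Fv v : (forall j, j \notin r -> v j = x j) -> f.@[mix r v (updz z m (z m))] = F v.
  by move=> vx; rewrite zm Fu -vx // upd_id.
have Frefl v t : f.@[mix r v (updz z m (- t - b m))] = f.@[mix r v (updz z m t)].
  rewrite !Fm -(reflect_inv_meval (fun j => if j == m then t else mix (m :: r) v z j) fm).
  by apply: meval_eq => j; rewrite eqxx; case: eqP.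
have forward : h.@[updz z m (z m)] / (2 * z m + b m) =
    hop (state_at s z) (moved (x m) (x m).+1 (b m)) *
      (diff_chain x (moved (x m) (x m).+1 (b m)) r F (upd x m (x m).+1)
       - diff_chain x (moved (x m) (x m).+1 (b m)) r F x).
  apply: hval => //.
  - by case: (x m) => [|k]; rewrite !inE eqxx ?orbT.
  - by rewrite moved_up.
  - rewrite (_ : 2 * z m + b m + 1 = b m + (2 * x m).+1%:R) ?bnat_add //.
    by rewrite zm -(natr1 (2 * x m)) natrM; ring.
  - by move=> v vx; rewrite zm natr1 Fu.
have zz : h.@[updz z m (z m)] = h.@[z].
  by apply: meval_eq => j; rewrite /updz; case: eqP => [->|].
rewrite (divdiff_meval _ n0) mulrBl -zz forward -/(updz z m (- z m - b m)).
case exm : (x m) => [|k].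
  rewrite /neighbours big_seq1 (_ : h.@[updz z m (- z m - b m)] = 0) ?mul0r ?subr0 //.
  rewrite mevalM link_meval sz {1}/updz eqxx zm exm link_at0 ?mul0r //.
  exact: g0.
rewrite /neighbours !big_cons big_nil addr0 addrC; congr (_ + _).
rewrite -exm -mulrN -invrN (_ : - (2 * z m + b m) = 2 * (- z m - b m) + b m);
  last by ring.
apply: hval.
- by rewrite exm !inE eqxx.
- by rewrite exm moved_down zm exm.
- by rewrite (_ : 2 * (- z m - b m) + b m = - (2 * z m + b m)) ?oppr_eq0 //; ring.
- rewrite (_ : 2 * (- z m - b m) + b m + 1 = - (b m + (2 *
  k).+1%:R)) ?oppr_eq0 ?bnat_add //.
  by rewrite zm exm -(natr1 (2 * k)) natrM -(natr1 k); ring.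
- move=> v vx; rewrite (_ : - z m - b m + 1 = - k%:R - b m) ?Frefl ?Fu //.
  by rewrite zm exm -(natr1 k); ring.
by move=> v vx; rewrite Frefl Fv.
Qed.

End GridValue.

(** * Substitutions on fractions *)

Section FracMap.
Variables (D : idomainType) (phi : {rmorphism D -> D}).
Hypothesis phi_inj : injective phi.
Local Notation "x %:F" := (FracField.tofrac x).

(** [frac_map] is defined through the chosen representative; the next lemmas
    show that it does not depend on it. *)
Lemma fracE (f : {fraction D}) : f = (\n_(repr f))%:F / (\d_(repr f))%:F.
Proof.
rewrite -{1}[f]reprK; move: (repr f) => x; unlock FracField.tofrac.
rewrite -[X in _ = _ * X]FracField.pi_inv -[RHS]FracField.pi_mul.
rewrite /FracField.invf /FracField.mulf !numden_Ratio ?oner_neq0 ?denom_ratioP //.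
by rewrite mulr1 mul1r Ratio_numden.
Qed.

Lemma phi_neq0 b : b != 0 -> phi b != 0.
Proof. by move=> b0; rewrite -(rmorph0 phi) (inj_eq phi_inj). Qed.

Lemma frac_map_div a b : b != 0 -> frac_map phi (a%:F / b%:F) = (phi a)%:F / (phi b)%:F.
Proof.
move=> b0; rewrite /frac_map; set f := a%:F / b%:F.
have d0 : \d_(repr f) != 0 by exact: denom_ratioP.
have e : \n_(repr f) * b = a * \d_(repr f).
  apply/eqP; rewrite -tofrac_eq !tofracM; apply/eqP.
  have := fracE f; rewrite {1}/f => e.
  have dF : (\d_(repr f))%:F != 0 by rewrite tofrac_eq0.
  have bF : b%:F != 0 by rewrite tofrac_eq0.
  have -> : (\n_(repr f))%:F = (a%:F / b%:F) * (\d_(repr f))%:F by rewrite e divfK.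
  by rewrite mulrAC divfK.
apply/eqP; rewrite eqr_div ?tofrac_eq0 ?phi_neq0 //.
by rewrite -!tofracM tofrac_eq -!rmorphM e.
Qed.

Lemma frac_map_tofrac a : frac_map phi a%:F = (phi a)%:F.
Proof. by rewrite -[a%:F]divr1 -tofrac1 frac_map_div ?oner_neq0 // rmorph1 tofrac1
  divr1. Qed.

Lemma frac_map_additive : zmod_morphism (frac_map phi).
Proof.
move=> f g; rewrite (fracE f) (fracE g).
move: (denom_ratioP (repr f)) (denom_ratioP (repr g)).
move: \n_(repr f) \d_(repr f) \n_(repr g) \d_(repr g) => a b c d b0 d0.
have F0 x : x != 0 -> x%:F != 0 by rewrite tofrac_eq0.
have -> : a%:F / b%:F - c%:F / d%:F = (a * d - c * b)%:F / (b * d)%:F.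
  by rewrite tofracB !tofracM -mulNr addf_div ?F0 // mulNr.
rewrite !frac_map_div ?mulf_neq0 // !(rmorphB, rmorphM) /=.
by rewrite -[X in _ = _ + X]mulNr addf_div ?F0 ?phi_neq0 // !mulNr.
Qed.

Lemma frac_map_multiplicative : monoid_morphism (frac_map phi).
Proof.
split; first by rewrite -tofrac1 frac_map_tofrac rmorph1.
move=> f g; rewrite (fracE f) (fracE g).
move: (denom_ratioP (repr f)) (denom_ratioP (repr g)).
move: \n_(repr f) \d_(repr f) \n_(repr g) \d_(repr g) => a b c d b0 d0.
rewrite mulf_div -!tofracM !frac_map_div ?mulf_neq0 //.
by rewrite mulf_div !rmorphM.
Qed.

End FracMap.

(** * The difference operator on fractions *)

Lemma cancel_axis (F : fieldType) (w g a a1 : F) : a1 != 0 -> a != 0 ->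
  w / (a * a1) * (a1 * g) = w * g / a.
Proof. by move=> a10 a0; field; rewrite a0 a10. Qed.

Section RatOp.
Variables (R : realType) (p : nat) (beta : 'I_p.+2 -> R) (N : nat).
Local Notation P := {mpoly R[p]}.
Local Notation ratfun := {fraction {mpoly R[p]}}.
Local Notation "x %:F" := (FracField.tofrac x).
Implicit Types (i j m l : 'I_p) (f g h : P) (c : R) (e : 'I_p -> nat) (r : seq 'I_p).
Implicit Types (s : bool * P * P).
Local Notation site_beta := (site_beta beta).
Local Notation bE := (beta (inord p.+1)).
Local Notation b0 := (beta (inord 0%N)).
Local Notation G := (chain_op site_beta bE N).
Local Notation site_state := (site_state site_beta).
Local Notation end_state := (end_state p bE N).
Local Notation reflect_inv := (reflect_inv site_beta).
Local Notation rho_ i := (refl i (site_beta i)).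

Lemma refl_inj i c : injective (refl i c : P -> P).
Proof. exact: inv_inj (reflK i c). Qed.

Lemma reflect_additive i : zmod_morphism (reflect_var beta i).
Proof. exact: (frac_map_additive (@refl_inj i (site_beta i))). Qed.
Lemma reflect_multiplicative i : monoid_morphism (reflect_var beta i).
Proof. exact: (frac_map_multiplicative (@refl_inj i (site_beta i))). Qed.
HB.instance Definition _ i :=
  GRing.isZmodMorphism.Build ratfun ratfun (reflect_var beta i) (reflect_additive i).
HB.instance Definition _ i :=
  GRing.isMonoidMorphism.Build ratfun ratfun (reflect_var beta i)
    (reflect_multiplicative i).

Lemma reflect_tofrac i f : reflect_var beta i f%:F = (rho_ i f)%:F.
Proof. exact: (frac_map_tofrac (@refl_inj i (site_beta i))). Qed.

Definition fshift i : P -> P := subst_var i ('X_i + 1).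
Definition bshift i : P -> P := subst_var i ('X_i - 1).

Lemma fshiftK i : cancel (fshift i) (bshift i).
Proof.
move=> f; rewrite /fshift /bshift subst_var_comp rmorphD rmorph1 /= subst_varXX subrK.
exact: subst_var_id.
Qed.

Lemma bshiftK i : cancel (bshift i) (fshift i).
Proof.
move=> f; rewrite /fshift /bshift subst_var_comp rmorphB rmorph1 /= subst_varXX addrK.
exact: subst_var_id.
Qed.

Lemma shift_tofrac i f : Defs.shift i f%:F = (fshift i f)%:F.
Proof. exact: (@frac_map_tofrac _ (subst_var i ('X_i + 1)) (can_inj (fshiftK i))). Qed.

Lemma shift_inv_tofrac i f : shift_inv i f%:F = (bshift i f)%:F.
Proof. exact: (@frac_map_tofrac _ (subst_var i ('X_i - 1)) (can_inj (bshiftK i))). Qed.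

Definition pfdiff i f := fshift i f - f.
Definition pbdiff i f := f - bshift i f.

Lemma fdiff_tofrac i f : fdiff i f%:F = (pfdiff i f)%:F.
Proof. by rewrite /fdiff shift_tofrac -tofracB. Qed.

Lemma bdiff_tofrac i f : bdiff i f%:F = (pbdiff i f)%:F.
Proof. by rewrite /bdiff shift_inv_tofrac -tofracB. Qed.

Definition seq_pow (A : Type) (D : 'I_p -> A -> A) (mu : 'I_p -> nat) r (f : A) : A :=
  foldr (fun i (x : A) => iter (mu i) (D i) x) f r.

Lemma seq_pow_tofrac (D : 'I_p -> ratfun -> ratfun) (D' : 'I_p -> P -> P) mu r f :
  (forall i g, D i g%:F = (D' i g)%:F) -> seq_pow D mu r f%:F = (seq_pow D' mu r f)%:F.
Proof.
move=> H; elim: r => [|i r IH] //=; rewrite IH.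
by elim: (mu i) => [|k IHk] //=; rewrite IHk H.
Qed.

Lemma seq_pow_comm (A : Type) (D : 'I_p -> A -> A) (O : A -> A) mu r (f : A) :
  (forall i (x : A), i \in r -> O (D i x) = D i (O x)) ->
  O (seq_pow D mu r f) = seq_pow D mu r (O f).
Proof.
elim: r => [|i r IH] //= H.
have {}IH : O (seq_pow D mu r f) = seq_pow D mu r (O f).
  by apply: IH => j x jr; apply: H; rewrite inE jr orbT.
rewrite -IH; move: (seq_pow D mu r f) => x.
by elim: (mu i) => [|k IHk] //=; rewrite H ?mem_head // IHk.
Qed.

Definition is_pos e i : nat := (e i == 2)%N.
Definition is_neg e i : nat := (e i == 0)%N.

Fixpoint chain_coeff s t : ratfun :=
  if t is m :: t' then
    (link s (site_state m))%:F / (axis m (site_beta m) * axis m (site_beta m + 1))%:F *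
      chain_coeff (site_state m) t'
  else if s.1.1 then (link s end_state)%:F else 0.

(** The term of the operator for one sign vector, with e i = 0, 1, 2 standing for
    nu_i = -1, 0, 1, before the reflections are collected in front. *)
Fixpoint chain_term s r f e : ratfun :=
  if r is m :: r' then
    if e m == 1%N then chain_term s r' f e
    else iter (is_neg e m) (reflect_var beta m)
      ((link s (site_state m))%:F / (axis m (site_beta m) * axis m (site_beta m + 1))%:F *
       chain_term (site_state m) r' (pfdiff m f) e)
  else if s.1.1 then (link s end_state)%:F * f%:F else 0.

Definition state_inv s i := rho_ i s.1.2 = s.1.2 /\ rho_ i s.2 = s.2.

Lemma state_inv_site i j : i != j -> state_inv (site_state j) i.
Proof.
by move=> ij; split; rewrite /= ?reflC //; apply: refl_indep; apply: indepX;
  rewrite eq_sym.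
Qed.

Lemma reflect_inv_pfdiff i j f : i != j -> reflect_inv i f -> reflect_inv i (pfdiff j f).
Proof.
move=> ij ff; rewrite /reflect_inv rmorphB /= ff; congr (_ - _).
rewrite /refl /fshift (subst_varAC _ ij) //; first by congr subst_var.
  by move=> q; rewrite rmorphD rmorph1 /= indepX // eq_sym.
by move=> q; rewrite rmorphB rmorphN /= subst_varC indepX.
Qed.

Lemma divstep_pfdiff i f : reflect_inv i f -> pfdiff i f = axis i (site_beta i + 1) *
  divstep site_beta i f.
Proof. by move=> ff; rewrite divstep_axis. Qed.

Lemma indeps_axis i c r : i \notin r -> indeps r (axis i c).
Proof.
move=> ir j jr q; have ij : i != j by apply: contraNneq ir => ->.
by rewrite /axis rmorphD rmorphM rmorph_nat /= subst_varC indepX.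
Qed.

Lemma axisF_neq0 i c : (axis i c)%:F != 0 :> ratfun.
Proof. by rewrite tofrac_eq0 axis_neq0. Qed.

(** For each site the three values of [e] are the deletion of the site and the two
    halves of a divided difference. *)
Lemma chain_op_iter_sum s r f v : uniq r -> (forall i, i \in r -> state_inv s i) ->
  (forall i, i \in r -> reflect_inv i f) ->
  (G s r f)%:F = iter_sum 3 r (chain_term s r f) v.
Proof.
elim: r s f v => [|m r IH] s f v /=.
  by case: ifP => _; rewrite ?tofracM.
move=> /andP[mr ur] sf ff.
have sr i : i \in r -> state_inv s i by move=> ir; apply: sf; rewrite inE ir orbT.
have fr i : i \in r -> reflect_inv i f by move=> ir; apply: ff; rewrite inE ir orbT.
have im i : i \in r -> i != m by move=> ir; apply: contraNneq mr => <-.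
have fm : reflect_inv m f by apply: ff; rewrite mem_head.
pose c : ratfun := (link s (site_state m))%:F / (axis m (site_beta m) *
  axis m (site_beta m + 1))%:F.
pose X : ratfun := c * (G (site_state m) r (pfdiff m f))%:F.
have key w : w m = 1%N -> iter_sum 3 r (chain_term s (m :: r) f) w = (G s r f)%:F.
  move=> wm; rewrite (IH s f w ur sr fr); apply: eq_iter_sum => e eo _.
  by rewrite /= eo // wm.
have keyX w : iter_sum 3 r (fun e => c * chain_term (site_state m) r (pfdiff m f) e) w
  = X.
  rewrite -iter_sumMl /X (IH (site_state m) (pfdiff m f) w) // => i ir.
    by apply: state_inv_site; apply: im.
  by apply: reflect_inv_pfdiff; [exact: im|exact: fr].
rewrite !big_ord_recl big_ord0 /= addr0.
rewrite (key (upd v m 1%N)) ?upd_same //.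
have -> : iter_sum 3 r (chain_term s (m :: r) f) (upd v m 0%N) = reflect_var beta m X.
  rewrite -(keyX (upd v m 0%N)) (iter_sum_morph 3 (reflect_var beta m)).
  by apply: eq_iter_sum => e eo _; rewrite /= /is_neg eo // upd_same.
have -> : iter_sum 3 r (chain_term s (m :: r) f) (upd v m 2%N) = X.
  rewrite -(keyX (upd v m 2%N)).
  by apply: eq_iter_sum => e eo _; rewrite /= /is_neg eo // upd_same.
rewrite tofracD addrA addrAC; congr (_ + _).
have eX : X = (link s (site_state m) * G (site_state m) r (divstep site_beta m f))%:F /
  (axis m (site_beta m))%:F.
  rewrite /X /c divstep_pfdiff // chain_op_mull; last exact: indeps_axis.
  rewrite !tofracM; have := axisF_neq0 m (site_beta m); have :=
    axisF_neq0 m (site_beta m + 1).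
  exact: cancel_axis.
have rX : reflect_var beta m X =
    - ((rho_ m (link s (site_state m) * G (site_state m) r (divstep site_beta m f)))%:F
      / (axis m (site_beta m))%:F).
  by rewrite eX rmorphM fmorphV /= !reflect_tofrac refl_axis tofracN invrN mulrN.
rewrite rX eX addrC -mulrBl -tofracB -divdiffE tofracM mulrAC mulfV ?mul1r //.
exact: axisF_neq0.
Qed.

Definition reflects r e (x : ratfun) : ratfun := seq_pow (reflect_var beta) (is_neg e)
  r x.

Lemma reflectsM r e x y : reflects r e (x * y) = reflects r e x * reflects r e y.
Proof.
rewrite /reflects; elim: r => [|i r IH] //=; rewrite IH.
by rewrite /is_neg; case: (e i == _) => //=; rewrite rmorphM.
Qed.

Lemma reflects_fix r e x : (forall i, i \in r -> reflect_var beta i x = x) ->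
  reflects r e x = x.
Proof.
rewrite /reflects; elim: r => [|i r IH] //= H; rewrite IH; last first.
  by move=> j jr; apply: H; rewrite inE jr orbT.
by rewrite /is_neg; case: (e i == _) => //=; rewrite H ?mem_head.
Qed.

Fixpoint chain_diff r e f : P :=
  if r is m :: r' then
    if e m == 1%N then chain_diff r' e f
    else iter (is_neg e m) (rho_ m) (chain_diff r' e (pfdiff m f))
  else f.

Definition chain_fixed s m r := forall i, i \in r ->
  reflect_var beta i ((link s (site_state m))%:F / (axis m (site_beta m) *
    axis m (site_beta m + 1))%:F) =
  (link s (site_state m))%:F / (axis m (site_beta m) * axis m (site_beta m + 1))%:F.

Lemma state_inv_chain s m r : m \notin r -> (forall i, i \in r -> state_inv s i) ->
  chain_fixed s m r.
Proof.
move=> mr sf i ir; have im : i != m by apply: contraNneq mr => <-.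
have [s1 s2] := sf i ir; have [m1 m2] := state_inv_site im.
have ax c : rho_ i (axis m c) = axis m c.
  by rewrite /refl (indeps_axis c mr ir).
rewrite rmorphM fmorphV /= !reflect_tofrac [rho_ i (_ * _)]rmorphM /= !ax.
rewrite link_morph ?orbT //= s1 s2 m1 m2.
by case: s {sf s1 s2} => [[a yl] bl].
Qed.

(** The reflections of later sites do not touch the factors of earlier ones, so
    they can all be moved to the front, separately on the coefficient and on the
    function. *)
Lemma chain_termE s r f e : uniq r -> (forall i, i \in r -> state_inv s i) ->
  chain_term s r f e = reflects r e (chain_coeff s [seq i <- r | e i != 1%N]) *
    (chain_diff r e f)%:F.
Proof.
elim: r s f => [|m r IH] s f /=.
  by move=> _ _; case: ifP; rewrite ?mul0r.
move=> /andP[mr ur] sf.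
have sr i : i \in r -> state_inv s i by move=> ir; apply: sf; rewrite inE ir orbT.
have im i : i \in r -> i != m by move=> ir; apply: contraNneq mr => <-.
have [em|em] /= := eqVneq (e m) 1%N.
  by rewrite IH // /is_neg em.
rewrite IH //; last by move=> i ir; apply: state_inv_site; apply: im.
rewrite reflectsM (reflects_fix _ (state_inv_chain mr sr)).
rewrite /is_neg; case: (e m == 0%N); last by rewrite /= mulrA.
by rewrite /= mulrA rmorphM /= reflect_tofrac.
Qed.

Lemma pfdiff_comm_subst i j q f : i != j -> indep j q ->
  subst_var i q (pfdiff j f) = pfdiff j (subst_var i q f).
Proof.
move=> ij jq; rewrite /pfdiff rmorphB /=; congr (_ - _); apply: subst_varAC => // q'.
by rewrite rmorphD rmorph1 /= indepX // eq_sym.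
Qed.

Lemma pbdiff_comm_subst i j q f : i != j -> indep j q ->
  subst_var i q (pbdiff j f) = pbdiff j (subst_var i q f).
Proof.
move=> ij jq; rewrite /pbdiff rmorphB /=; congr (_ - _); apply: subst_varAC => // q'.
by rewrite rmorphB rmorph1 /= indepX // eq_sym.
Qed.

Lemma indep_aff i j : i != j -> [/\ indep j ('X_i + 1 : P), indep j ('X_i - 1 : P) &
  forall c, indep j (- 'X_i - c%:MP : P)].
Proof.
move=> ij; split=> [q|q|c q].
- by rewrite rmorphD rmorph1 /= indepX.
- by rewrite rmorphB rmorph1 /= indepX.
by rewrite rmorphB rmorphN /= subst_varC indepX.
Qed.

(** This is why the operator carries the sign (-1)^|nu^-|. *)
Lemma refl_pfdiff m f : reflect_inv m f -> rho_ m (pfdiff m f) = - pbdiff m f.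
Proof.
move=> ff; rewrite /pfdiff rmorphB /= ff /pbdiff opprB; congr (_ - _).
have e1 : rho_ m (fshift m f) = subst_var m (- 'X_m - (site_beta m)%:MP + 1) f.
  by rewrite /refl /fshift subst_var_comp rmorphD rmorph1 /= subst_varXX.
have e2 : bshift m (rho_ m f) = subst_var m (- ('X_m - 1) - (site_beta m)%:MP) f.
  by rewrite /refl /bshift subst_var_comp rmorphB rmorphN /= subst_varC subst_varXX.
have e3 : - ('X_m - 1) - (site_beta m)%:MP = - 'X_m - (site_beta m)%:MP + 1 :> P by ring.
by rewrite e1 -e3 -e2 (ff : rho_ m f = f).
Qed.

Definition num_neg r e : nat := (\sum_(i <- r) is_neg e i)%N.

Lemma seq_powN (D : 'I_p -> P -> P) mu r f : (forall i g, D i (- g) = - D i g) ->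
  seq_pow D mu r (- f) = - seq_pow D mu r f.
Proof.
move=> DN; elim: r => [|i r IH] //=; rewrite IH.
by elim: (mu i) => [|k IHk] //=; rewrite IHk DN.
Qed.

Lemma pfdiffN i g : pfdiff i (- g) = - pfdiff i g.
Proof. by rewrite /pfdiff /fshift rmorphN; ring. Qed.

Lemma pbdiffN i g : pbdiff i (- g) = - pbdiff i g.
Proof. by rewrite /pbdiff /bshift rmorphN; ring. Qed.

Lemma pfdiffB i f g : pfdiff i (f - g) = pfdiff i f - pfdiff i g.
Proof. by rewrite /pfdiff /fshift rmorphB /=; ring. Qed.

Lemma pbdiffB i f g : pbdiff i (f - g) = pbdiff i f - pbdiff i g.
Proof. by rewrite /pbdiff /bshift rmorphB /=; ring. Qed.

Lemma pfdiff_comm i j f : i != j -> pfdiff i (pfdiff j f) = pfdiff j (pfdiff i f).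
Proof.
move=> ij; have [h _ _] := indep_aff ij.
have e : fshift i (pfdiff j f) = pfdiff j (fshift i f) := pfdiff_comm_subst f ij h.
by change (fshift i (pfdiff j f) - pfdiff j f = pfdiff j (fshift i f - f));
  rewrite e pfdiffB.
Qed.

Lemma pfdiff_pbdiff_comm i j f : i != j -> pfdiff i (pbdiff j f) = pbdiff j (pfdiff i f).
Proof.
move=> ij; have [h _ _] := indep_aff ij.
have e : fshift i (pbdiff j f) = pbdiff j (fshift i f) := pbdiff_comm_subst f ij h.
by change (fshift i (pbdiff j f) - pbdiff j f = pbdiff j (fshift i f - f));
  rewrite e pbdiffB.
Qed.

Lemma pbdiff_comm i j f : i != j -> pbdiff i (pbdiff j f) = pbdiff j (pbdiff i f).
Proof.
move=> ij; have [_ h _] := indep_aff ij.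
have e : bshift i (pbdiff j f) = pbdiff j (bshift i f) := pbdiff_comm_subst f ij h.
by change (pbdiff j f - bshift i (pbdiff j f) = pbdiff j (f - bshift i f));
  rewrite e pbdiffB.
Qed.

Lemma chain_diffE r e f : uniq r -> (forall i, i \in r -> (e i < 3)%N) ->
  (forall i, i \in r -> reflect_inv i f) ->
  chain_diff r e f = (-1) ^+ num_neg r e * seq_pow pfdiff (is_pos e) r (seq_pow pbdiff
    (is_neg e) r f).
Proof.
elim: r f => [|m r IH] f /=; first by rewrite /num_neg big_nil mul1r.
move=> /andP[mr ur] e3 ff.
have fr i : i \in r -> reflect_inv i f by move=> ir; apply: ff; rewrite inE ir orbT.
have er i : i \in r -> (e i < 3)%N by move=> ir; apply: e3; rewrite inE ir orbT.
have im i : i \in r -> i != m by move=> ir; apply: contraNneq mr => <-.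
have mi i : i \in r -> m != i by move=> ir; rewrite eq_sym im.
have fm : reflect_inv m f by apply: ff; rewrite mem_head.
have commf (O : P -> P) g : (forall i h, i \in r -> O (pfdiff i h) = pfdiff i (O h)) ->
    (forall i h, i \in r -> O (pbdiff i h) = pbdiff i (O h)) ->
    O (seq_pow pfdiff (is_pos e) r (seq_pow pbdiff (is_neg e) r g)) =
      seq_pow pfdiff (is_pos e) r (seq_pow pbdiff (is_neg e) r (O g)).
  by move=> H1 H2; rewrite (seq_pow_comm _ _ H1) (seq_pow_comm _ _ H2).
have sub_comm q : (forall i, i \in r -> indep i q) -> forall g,
    subst_var m q (seq_pow pfdiff (is_pos e) r (seq_pow pbdiff (is_neg e) r g)) =
    seq_pow pfdiff (is_pos e) r (seq_pow pbdiff (is_neg e) r (subst_var m q g)).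
  move=> iq g; apply: commf => i h ir.
    exact: pfdiff_comm_subst (mi i ir) (iq i ir).
  exact: pbdiff_comm_subst (mi i ir) (iq i ir).
rewrite /num_neg big_cons -/(num_neg r e).
have [em|em] /= := eqVneq (e m) 1%N.
  by rewrite IH // /is_pos /is_neg em.
rewrite IH //; last by move=> i ir; apply: reflect_inv_pfdiff; [exact: im|exact: fr].
have e3m : (e m < 3)%N by apply: e3; rewrite mem_head.
have [em0|em0] := eqVneq (e m) 0%N.
  rewrite /is_pos /is_neg em0 /= -/(is_pos e) -/(is_neg e).
  rewrite rmorphM rmorphXn rmorphN rmorph1 /= /refl sub_comm; last first.
    by move=> i ir; have [_ _] := indep_aff (mi i ir); apply.
  rewrite -/(refl m _ _) refl_pfdiff // !seq_powN; [|exact: pfdiffN|exact: pbdiffN].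
  rewrite exprS mulN1r mulrN mulNr; congr (- (_ * seq_pow pfdiff _ r _)).
  by apply/esym/seq_pow_comm => i h ir; apply: pbdiff_comm; exact: mi.
have em2 : e m = 2%N by move: e3m em em0; case: (e m) => [|[|[|]]].
rewrite /is_pos /is_neg em2 /= -/(is_pos e) -/(is_neg e) add0n; congr (_ * _).
apply/esym/commf => i h ir; first by apply: pfdiff_comm; exact: mi.
by apply: pfdiff_pbdiff_comm; exact: mi.
Qed.

End RatOp.

Section RatLp.
Variables (R : realType) (p : nat) (beta : 'I_p.+2 -> R) (N : nat).
Local Notation P := {mpoly R[p]}.
Local Notation ratfun := {fraction {mpoly R[p]}}.
Local Notation "x %:F" := (FracField.tofrac x).
Implicit Types (i j m l : 'I_p) (f : P).
Local Notation site_beta := (site_beta beta).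
Local Notation bE := (beta (inord p.+1)).
Local Notation b0 := (beta (inord 0%N)).
Local Notation site_state := (site_state site_beta).
Local Notation end_state := (end_state p bE N).
Local Notation s0 := (false, 0, b0%:MP).
Local Notation chain_coeff := (chain_coeff beta N).
Let x i : ratfun := ('X_i)%:F.
Let b k : ratfun := ((beta (inord k))%:MP)%:F.
Let den i : ratfun := (2 * x i + b i.+1) * (2 * x i + b i.+1 + 1).
Let pair (ij : 'I_p * 'I_p) : ratfun :=
  (x ij.2 + x ij.1 + b ij.2.+1) * (x ij.2 + x ij.1 + b ij.2.+1 + 1).

Lemma axisF i c : (axis i c)%:F = 2 * x i + (c%:MP)%:F.
Proof. by rewrite /axis tofracD tofracM (rmorph_nat (@FracField.tofrac _)). Qed.

Lemma denE i : (axis i (site_beta i) * axis i (site_beta i + 1))%:F = den i.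
Proof. by rewrite tofracM !axisF mpolyCD mpolyC1 tofracD tofrac1 addrA. Qed.

Lemma link_stF l i : (link (site_state l) (site_state i))%:F = pair (l, i).
Proof.
by rewrite /link /= tofracM !tofracD tofrac1.
Qed.

Lemma link_endF l : (link (site_state l) end_state)%:F = (x l + b p.+1 + N%:R) *
  (N%:R - x l).
Proof.
rewrite /link /= tofracM tofracB !tofracD (rmorph_nat (@FracField.tofrac _)) mulrC.
by congr (_ * _); rewrite -addrA addrC.
Qed.

Lemma div_regroup (F : fieldType) (P1 P2 d D X : F) :
  P1 / d * (P2 / D * X) = P1 * P2 / (d * D) * X.
Proof. by rewrite invfM mulrA mulrACA. Qed.

Lemma div_regroup_last (F : fieldType) (P1 P2 d D X Y : F) :
  P1 / d * (P2 / D * (X * Y)) = P1 * (P2 / (d * D)) * X * Y.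
Proof. by rewrite div_regroup !mulrA. Qed.

Lemma chain_coeffE l t : chain_coeff (site_state l) t =
  (\prod_(ij <- zip (l :: t) t) pair ij / \prod_(i <- t) den i) *
  ((x (last l t) + b p.+1 + N%:R) * (N%:R - x (last l t))).
Proof.
elim: t l => [|m t IH] l /=.
  by rewrite !big_nil divr1 mul1r link_endF.
by rewrite IH link_stF denE div_regroup !big_cons.
Qed.

Lemma A01E mu : A01 beta N mu = chain_coeff s0 [seq i <- enum 'I_p | mu i != 0%N].
Proof.
rewrite /A01; case: [seq i <- enum 'I_p | mu i != 0%N] => [|i1 t] //=.
rewrite chain_coeffE denE.
have -> : (link s0 (site_state i1))%:F = (x i1 + b i1.+1 - b 0%N) * (x i1 + b i1.+1).
  by rewrite /link /= addr0 subr0 tofracM mulrC tofracB !tofracD.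
by rewrite div_regroup_last big_cons.
Qed.

Lemma pos_partE (e : {ffun 'I_p -> 'I_3}) : pos_part (sgn_index e) =
  is_pos (fun i => e i).
Proof.
apply/funext => i; rewrite /pos_part /sgn_index /is_pos.
by case: (e i) => [[|[|[|]]]].
Qed.

Lemma neg_partE (e : {ffun 'I_p -> 'I_3}) : neg_part (sgn_index e) =
  is_neg (fun i => e i).
Proof.
apply/funext => i; rewrite /neg_part /sgn_index /is_neg.
by case: (e i) => [[|[|[|]]]].
Qed.

(** On invariant polynomials the rational operator is the chain operator with the
    site 0 at its left end. *)
Lemma Lp_tofrac f : (forall i, reflect_inv site_beta i f) ->
  Lp beta N f%:F = (Lpoly beta N bE b0 f)%:F.
Proof.
move=> ff; rewrite /Lpoly (@chain_op_iter_sum _ _ _ _ s0 (enum 'I_p) f (fun=> 0%N))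
  ?enum_uniq //; last first.
  by move=> i _; split; rewrite /= ?rmorph0 ?reflC.
rewrite iter_sum_ffun /Lp big_mkcond /=; apply: eq_bigr => e _.
rewrite chain_termE ?enum_uniq //; last by move=> i _; split; rewrite /= ?rmorph0 ?reflC.
case: ifP => [_|/negbT]; last first.
  rewrite negb_exists => /forallP e1.
  have -> : [seq i <- enum 'I_p | (e i : nat) != 1%N] = [::].
    apply/eqP; rewrite -(negbK (_ == _)) -has_filter; apply/hasPn => i _ /=.
    by have := e1 i; rewrite /sgn_index; case: (e i) => [[|[|[|]]]].
  by rewrite reflects_fix ?mul0r // => i _; rewrite raddf0.
rewrite chain_diffE ?enum_uniq // /A pos_partE neg_partE /num_neg big_enum /=.
rewrite tofracM rmorphXn rmorphN rmorph1 /=.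
rewrite mulrCA mulrA; congr (_ * _ * _).
  rewrite A01E /reflects -/(seq_pow _ _ _ _).
  congr (seq_pow _ _ _ (chain_coeff s0 _)); apply: eq_filter => i.
  by rewrite /is_pos /is_neg; case: (e i) => [[|[|[|]]]].
rewrite -(seq_pow_tofrac _ _ _ (@fdiff_tofrac R p)) -(seq_pow_tofrac _ _ _
  (@bdiff_tofrac R p)).
by [].
Qed.

End RatLp.

(** * Self-adjointness *)

Arguments ext_point : simpl never.

Lemma iter_sum_shrink (I : eqType) (V : nmodType) (n : nat) (r : seq I)
    (H : (I -> nat) -> V) v : uniq r ->
  (forall e m, m \in r -> e m = n -> H e = 0) ->
  iter_sum n.+1 r H v = iter_sum n r H v.
Proof.
elim: r v => [|m r IH] v //= /andP[mr ur] H0.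
have Hr e m' : m' \in r -> e m' = n -> H e = 0.
  by move=> m'r; apply: H0; rewrite inE m'r orbT.
rewrite big_ord_recr /= -[RHS]addr0; congr (_ + _).
  by apply: eq_bigr => y _; apply: IH.
rewrite (@eq_iter_sum _ _ _ _ H (fun=> 0)) ?iter_sum0 // => e eo _.
by apply: (H0 e m); rewrite ?mem_head // eo // upd_same.
Qed.

Lemma path_rcons_max a s M : path leq a (rcons s M) -> (a <= M)%N && all (leq^~ M) s.
Proof.
elim: s a => [|c s IH] a /=; first by rewrite !andbT.
by move=> /andP[ac /IH /andP[cM ->]]; rewrite cM (leq_trans ac cM).
Qed.

Section Final.
Variables (R : realType) (p : nat) (beta : 'I_p.+2 -> R) (N : nat).
Local Notation P := {mpoly R[p]}.
Local Notation point := {ffun 'I_p -> 'I_N.+1}.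
Implicit Types (i j : 'I_p) (f g h : P) (x y : point).
Local Notation site_beta := (site_beta beta).
Local Notation bE := (beta (inord p.+1)).
Local Notation b0 := (beta (inord 0%N)).
Local Notation enm := (enum 'I_p).
Let tend : bool * R * R := (false, N%:R, bE).
Local Notation X := ext_point.
Definition coords x : 'I_p -> nat := fun i => x i.

Lemma drop_enum k (h : (k < p)%N) : drop k enm = Ordinal h :: drop k.+1 enm.
Proof.
rewrite (drop_nth (Ordinal h)) ?size_enum_ord //.
by have -> : nth (Ordinal h) enm k = Ordinal h := nth_ord_enum (Ordinal h) (Ordinal h).
Qed.

Lemma drop_enum_end : drop p enm = [::].
Proof. by rewrite drop_oversize // size_enum_ord. Qed.

Lemma ext_point_ord x k (h : (k < p)%N) : X x k.+1 = x (Ordinal h).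
Proof. by rewrite /ext_point insubT. Qed.

Lemma ext_point_end x : X x p.+1 = N.
Proof. by rewrite /ext_point insubN // ltnn. Qed.

Lemma downward (Q : nat -> Prop) : Q p ->
  (forall k, (k < p)%N -> Q k.+1 -> Q k) -> Q 0%N.
Proof.
move=> Qp Qs; suff H d : (d <= p)%N -> Q (p - d)%N by rewrite -(subnn p); exact: H.
elim: d => [|d IH] dp; first by rewrite subn0.
by apply: Qs; [clear -dp; lia|rewrite subnSK //; apply: IH; exact: ltnW].
Qed.

Let wfac x k := pair_weight (X x k) (beta (inord k)) (X x k.+1) (beta (inord k.+1)).

Lemma rho_weight_chain x : rho beta x = weight_chain site_beta bE N 0 b0 enm (coords x).
Proof.
rewrite /rho -(big_mkord xpredT (wfac x)).
pose Q k := weight_chain site_beta bE N (X x k) (beta (inord k)) (drop k enm) (coords x) =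
  (\prod_(k <= j < p.+1) wfac x j) *
  \prod_(k.+1 <= j < p.+1) (beta (inord j) + 2 * (X x j)%:R).
suff : Q 0%N by rewrite /Q drop0 => ->.
apply: downward => [|k kp]; rewrite /Q.
  rewrite drop_enum_end big_nat1 big_geq // mulr1 /=.
  by rewrite /wfac ext_point_end.
rewrite (drop_enum kp) /= /coords -(ext_point_ord x kp) => ->.
rewrite [in RHS]big_ltn ?[X in _ = _ * X]big_ltn ?ltnS ?(ltnW kp) //=.
by rewrite -/(wfac x k) mulrACA.
Qed.

Lemma in_VN_path x : in_VN x = path leq 0 (rcons (map (coords x) enm) N).
Proof.
pose Q k := (forall j : nat, (k <= j)%N -> (j < p.+1)%N -> (X x j <= X x j.+1)%N) <->
  path leq (X x k) (rcons (map (coords x) (drop k enm)) N).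
have : Q 0%N.
  apply: downward => [|k kp]; rewrite /Q.
    rewrite drop_enum_end /= andbT; split=> [H|H j].
      by have := H p (leqnn p) (ltnSn p); rewrite ext_point_end.
    rewrite ltnS => pj jp; have -> : j = p by apply/eqP; rewrite eqn_leq jp.
    by rewrite ext_point_end.
  rewrite (drop_enum kp) /= /coords -(ext_point_ord x kp) => -[H1 H2].
  split=> [H|/andP[le pt] j kj jp].
    rewrite H ?ltnS ?(ltnW kp) //=; apply: H1 => j kj; apply: H; exact: ltnW.
  move: kj; rewrite leq_eqVlt => /predU1P[<- //|kj]; exact: H2.
rewrite /Q drop0 => -[H1 H2]; apply/forallP/idP => [H|/H2 H k].
  by apply: H1 => j _ jp; exact: (H (Ordinal jp)).
exact: H.
Qed.

Hypothesis hrho : rho_well_defined beta N.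

Lemma regular_chainP x : in_VN x -> regular_chain site_beta bE N 0 b0 enm (coords x).
Proof.
move=> xV; have H := hrho xV.
pose Q k := regular_chain site_beta bE N (X x k) (beta (inord k)) (drop k enm) (coords x).
suff : Q 0%N by rewrite /Q drop0.
apply: downward => [|k kp]; rewrite /Q.
  by have := H (Ordinal (ltnSn p)); rewrite drop_enum_end /= ext_point_end.
rewrite (drop_enum kp) /= /coords -(ext_point_ord x kp) => rk; split=> //.
exact: (H (Ordinal (leqW kp : (k < p.+1)%N))).
Qed.

(** The point 0 of the lattice already forbids these values. *)
Lemma site_beta_nat i (n : nat) : site_beta i != - n%:R.
Proof.
pose x : point := [ffun=> ord0].
have X0 k : (k <= p)%N -> X x k = 0%N.
  by case: k => [|k] // kp; rewrite (ext_point_ord x kp) ffunE.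
have xV : in_VN x by apply/forallP => k; rewrite X0 // -ltnS.
have [_] := hrho xV (widen_ord (leqnSn p) i).
rewrite /= !X0 ?addr0 //; last exact: ltnW.
by move=> H; apply/eqP => e; apply: H; exists n.
Qed.

Definition grid_value x f : R := f.@[fun i => (x i)%:R].
Definition grid_kernel x y : R := chain_kernel site_beta tend (coords x) (moved 0 0 b0)
  enm (coords y).
(** The coefficient of the empty subset: a constant, so it does not affect
    self-adjointness. *)
Definition zero_coeff : R := link (moved 0 0 b0) tend.

Lemma grid_kernel_sym x y : in_VN x -> in_VN y -> rho beta x * grid_kernel x y =
  rho beta y * grid_kernel y x.
Proof.
move=> xV yV; rewrite !rho_weight_chain.
apply: (chain_sym site_beta_nat); rewrite -?in_VN_path //; exact: regular_chainP.
Qed.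

Lemma Lpoly_grid_value f x : (forall i, reflect_inv site_beta i f) -> in_VN x ->
  grid_value x (Lpoly beta N bE b0 f) + zero_coeff * grid_value x f =
    \sum_(y | in_VN y) grid_kernel x y * grid_value y f.
Proof.
move=> ff xV; have xp : path leq 0 (rcons (map (coords x) enm) N) by rewrite -in_VN_path.
pose s : bool * P * P := (false, 0, b0%:MP).
have es : state_at s (fun i => (x i)%:R) = moved 0 0 b0 by rewrite moved_id /state_at
  /= meval0 mevalC.
have gx : admissible (coords x) (moved 0 0 b0) enm.
  split; first by rewrite moved_id.
  move: xp; rewrite rcons_path => /andP[/path_sorted + _].
  by rewrite sorted_map.
have := @chain_op_meval _ _ site_beta bE N site_beta_nat s enm f (coords x) (fun i =>
  (x i)%:R)
  (enum_uniq _) (fun _ _ => erefl) (fun i _ => ff i).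
rewrite es /= => -> //; last first.
  by move=> i _; split; [move=> q; rewrite rmorph0|exact: indepC].
(* A move can lead to N + 1, hence the bound N + 2; the kernel is 0 there. *)
rewrite (diff_chain_shift_chain _ site_beta_nat) // (@shift_chain_iter_sum _ _ _ _ _ _
  _ _ _ N.+2) ?enum_uniq //; last first.
  by move=> i _; exact: (ltn_ord (x i)).
have supp e : chain_kernel site_beta tend (coords x) (moved 0 0 b0) enm e != 0 ->
    path leq 0 (rcons (map e enm) N).
  exact: chain_kernel_support.
rewrite iter_sum_shrink ?enum_uniq //; last first.
  move=> e m _ em; apply/eqP; rewrite mulf_eq0; apply/orP; left.
  apply: contraT => /supp.
  move/path_rcons_max => /andP[_ /allP/(_ (e m))]; rewrite em ltnn.
  by apply; rewrite -em map_f ?mem_enum.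
rewrite iter_sum_ffun [RHS]big_mkcond /=; apply: eq_bigr => y _.
case: ifPn => [yV|].
  by congr (_ * _); apply: meval_eq => i; rewrite /mix mem_enum.
rewrite in_VN_path => yN; rewrite (_ : chain_kernel _ _ _ _ _ _ = 0) ?mul0r //.
by apply/eqP; apply: contraNT yN => /supp.
Qed.

(** Up to a multiple of the inner product, <L f, g> is a sum over pairs of
    lattice points with a symmetric kernel. *)
Lemma ip_sym f g : (forall i, reflect_inv site_beta i f) ->
  (forall i, reflect_inv site_beta i g) ->
  racah_ip beta N (Lpoly beta N bE b0 f) g = racah_ip beta N f (Lpoly beta N bE b0 g).
Proof.
move=> ff fg; rewrite /racah_ip.
pose S f g := \sum_(x | in_VN x) \sum_(y | in_VN y) rho beta x * grid_kernel x y *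
  grid_value y f * grid_value x g.
have SE f1 g1 : (forall i, reflect_inv site_beta i f1) ->
    \sum_(x | in_VN x) grid_value x (Lpoly beta N bE b0 f1) * grid_value x g1 *
      rho beta x =
    S f1 g1 - zero_coeff * \sum_(x | in_VN x) grid_value x f1 * grid_value x g1 *
      rho beta x.
  move=> ff1; rewrite mulr_sumr -sumrB; apply: eq_bigr => x xV.
  have -> : grid_value x (Lpoly beta N bE b0 f1) =
    \sum_(y | in_VN y) grid_kernel x y * grid_value y f1 - zero_coeff *
      grid_value x f1 by rewrite -Lpoly_grid_value // addrK.
  have -> : \sum_(y | in_VN y) rho beta x * grid_kernel x y * grid_value y f1 *
    grid_value x g1 =
    rho beta x * grid_value x g1 * \sum_(y | in_VN y) grid_kernel x y * grid_value y f1.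
    by rewrite mulr_sumr; apply: eq_bigr => y _; ring.
  ring.
have -> : \sum_(x | in_VN x) grid_value x f * grid_value x (Lpoly beta N bE b0 g) *
  rho beta x =
    \sum_(x | in_VN x) grid_value x (Lpoly beta N bE b0 g) * grid_value x f * rho beta x.
  by apply: eq_bigr => x _; rewrite [_ * grid_value x f]mulrC.
rewrite !SE //; congr (_ - _ * _); last by apply: eq_bigr => x _;
  rewrite [grid_value x f * _]mulrC.
rewrite /S exchange_big /=; apply: eq_bigr => x xV; apply: eq_bigr => y yV.
by rewrite (grid_kernel_sym yV xV); ring.
Qed.

End Final.

(** * The eigenvalue equation *)

Section Last.
Variables (R : realType) (p : nat) (beta : 'I_p.+2 -> R) (N : nat).
Local Notation bE := (beta (inord p.+1)).
Local Notation b0 := (beta (inord 0%N)).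

Lemma inPN1 (f : {mpoly R[p]}) : in_Plambda_le beta (-1) f -> f = 0.
Proof.
move=> [h [hd ->]]; suff -> : h = 0 by rewrite comp_mpoly0.
by apply/eqP; rewrite -msize_poly_eq0; move: hd; rewrite addNr lez_nat leqn0.
Qed.

Lemma Lpoly_inP (d : nat) f : in_Plambda_le beta d%:Z f ->
  in_Plambda_le beta d%:Z (Lpoly beta N bE b0 f).
Proof.
move=> fP; have LP := Lpoly_lead N bE b0 fP.
rewrite -[Lpoly _ _ _ _ _](addrK (eigen bE b0 d *: f)) -scaleNr.
apply: inPD; last exact: inPZ.
by apply: inPW LP; clear; lia.
Qed.

Lemma Lpoly_inP_pred (d : nat) f : in_Plambda_le beta (d%:Z - 1) f ->
  in_Plambda_le beta (d%:Z - 1) (Lpoly beta N bE b0 f).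
Proof.
case: d => [|d] fP; last by rewrite intS addrC addKr in fP *; exact: Lpoly_inP.
by rewrite (inPN1 fP) /Lpoly (raddf0 (chain_op _ _ _ _ _)); apply: inP0.
Qed.

(** The remainder q of the leading term is orthogonal to itself: it is of lower
    degree, and so is its image under the self-adjoint operator. *)
Lemma Lpoly_eigen (d : nat) f : (d <= N)%N ->
  rho_well_defined beta N -> racah_pos_def beta N ->
  in_Plambda_le beta d%:Z f ->
  (forall g, in_Plambda_le beta (d%:Z - 1) g -> racah_ip beta N f g = 0) ->
  Lpoly beta N bE b0 f = - eigen bE b0 d *: f.
Proof.
move=> dN hrho hpos fP forth.
pose q := Lpoly beta N bE b0 f + eigen bE b0 d *: f.
have qP : in_Plambda_le beta (d%:Z - 1) q := Lpoly_lead N bE b0 fP.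
suff q0 : q = 0 by rewrite scaleNr; apply/eqP; rewrite -addr_eq0 -/q q0.
apply/eqP; apply: contraT => qn0.
have qN : in_Plambda_le beta N%:Z q by apply: inPW qP; clear -dN; lia.
have := hpos q qN qn0.
have ffix i : reflect_inv (site_beta beta) i f := inP_reflect_inv i fP.
have qfix i : reflect_inv (site_beta beta) i q := inP_reflect_inv i qP.
have ipD g1 g2 c : racah_ip beta N (g1 + c *: g2) q =
    racah_ip beta N g1 q + c * racah_ip beta N g2 q.
  rewrite /racah_ip mulr_sumr -big_split /=; apply: eq_bigr => x _.
  by rewrite mevalD mevalZ; ring.
rewrite {1}/q ipD (forth q qP) mulr0 addr0 (ip_sym hrho ffix qfix) forth ?ltxx //.
exact: Lpoly_inP_pred.
Qed.

End Last.

Theorem theorem3p6 (R : realType) (p : nat) (hp : (1 <= p)%N)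
    (beta : 'I_p.+2 -> R) (N : nat)
    (hrho : rho_well_defined beta N)
    (hpos : racah_pos_def beta N)
    (Q : 'X_{1..p < N.+1} -> {mpoly R[p]})
    (hspan : forall f : {mpoly R[p]}, in_Plambda_le beta N%:Z f ->
       exists c : 'X_{1..p < N.+1} -> R, f = \sum_n c n *: Q n)
    (hdeg : forall n : 'X_{1..p < N.+1}, Plambda_degree beta (mdeg n) (Q n))
    (horth : forall (n : 'X_{1..p < N.+1}) (g : {mpoly R[p]}),
       in_Plambda_le beta ((mdeg n)%:Z - 1) g -> racah_ip beta N (Q n) g = 0) :
  forall n : 'X_{1..p < N.+1},
    Lp beta N (FracField.tofrac (Q n)) =
    FracField.tofrac
      ((- ((mdeg n)%:R *
           ((mdeg n)%:R - 1 + beta (inord p.+1) - beta (inord 0%N)))) *: Q n).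
Proof.
move=> n; have nN : (mdeg n <= N)%N by rewrite -ltnS bmdeg.
have QP : in_Plambda_le beta (mdeg n)%:Z (Q n).
  have [h [hs ->]] := hdeg n; exists h; split=> //.
  by rewrite hs -addn1 PoszD.
rewrite Lp_tofrac => [|i]; last exact: inP_reflect_inv QP.
by rewrite (Lpoly_eigen nN hrho hpos QP (horth n)).
Qed.
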